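(* Let $E,G$ be Banach spaces, $B\colon E\times E\to G$ a bounded bilinear map and $(\pi_n)$ a sequence of partitions of $\mathbb R_{\ge0}$. Suppose that $X\in D(\mathbb R_{\ge0},E)$ has weak $B$-quadratic variation $Q_B(X,X)$ and scalar quadratic variation $Q(X)$ along $(\pi_n)$ and that $(\pi_n)$ satisfies Condition (C) for $X$. If $G$ has the Radon--Nikodym property, then there is a $q_B\in L^1_{\mathrm{loc}}(Q(X);G)$ such that $$Q_B(X,X)_t=\int_{]0,t]}q_B(s)\,\mathrm dQ(X)_s\qquad\text{for all }t\ge0,$$ and $\|q_B(s)\|_G\le\|B\|$ for $\mathrm dQ(X)$-almost every $s$. Moreover, for all $t\ge0$, $$V(Q_B(X,X))_t=\int_{]0,t]}\|q_B(s)\|\,\mathrm dQ(X)_s .$$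
   Context: Banach spaces are real. A partition of $\mathbb R_{\ge0}$ is a set $\pi=\{\,]t_i,t_{i+1}] : i\in\mathbb N\}$ with $0=t_0<t_1<\dots\to\infty$. For $t>0$, $\pi(t)$ is the unique element of $\pi$ containing $t$. $D(\mathbb R_{\ge0},E)$ is the set of càdlàg paths; $\Delta X_t=X_t-X_{t-}$ for $t>0$, $\Delta X_0=0$; for $I=]r,s]$, $\delta X_t(I)=X_{s\wedge t}-X_{r\wedge t}$. $V(A)_t$ is the total variation of a path $A$ on $[0,t]$. Weak $B$-quadratic variation along $(\pi_n)$: a $G$-valued càdlàg path $Q_B(X,X)$ of finite variation (on compact intervals) such that $\sum_{I\in\pi_n}B(\delta X_t(I),\delta X_t(I))\to Q_B(X,X)_t$ weakly in $G$ for every $t\ge0$, and $\Delta Q_B(X,X)_t=B(\Delta X_t,\Delta X_t)$ for all $t$. Scalar quadratic variation along $(\pi_n)$: a real càdlàg increasing path $Q(X)$ with $\sum_{I\in\pi_n}\|\delta X_t(I)\|^2\to Q(X)_t$ for every $t\ge0$ and $\Delta Q(X)_t=\|\Delta X_t\|^2$ for all $t$. $L^1_{\mathrm{loc}}(Q(X);G)$ is the space of $G$-valued functions on $\mathbb R_{\ge0}$ that are locally Bochner integrable with respect to the Stieltjes measure $\mathrm dQ(X)$. Let $D(X)=\{t:\Delta X_t\ne0\}$, $D_\varepsilon(X)=\{t:\|\Delta X_t\|>\varepsilon\}$, $J_\varepsilon(X)_t=\sum_{0<s\le t}\Delta X_s1_{D_\varepsilon(X)}(s)$, and $O^+_t(Z,\pi)=\sup_{]r,s]\in\pi}\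 \sup_{u,v\in]r,s]\cap[0,t]}\|Z_u-Z_v\|$. $(\pi_n)$ satisfies Condition (C) for $X$ if: (C1) for all $t\ge0$, $\varepsilon>0$ there is $N$ such that $I\cap[0,t]\cap D_\varepsilon(X)$ has at most one element for all $n\ge N$, $I\in\pi_n$; (C2) $\delta X_t(\pi_n(s))\to\Delta X_s$ for all $s\in D(X)$ and $t\ge s$; (C3) for all $t\ge 0$, $\varlimsup_{\varepsilon\downarrow0}\varlimsup_{n\to\infty}O^+_t(X-J_\varepsilon(X),\pi_n)=0$. $G$ has the Radon--Nikodym property if for every finite positive measure space $(\Omega,\mathcal A,\mu)$ and every $\mu$-absolutely continuous vector measure $\nu\colon\mathcal A\to G$ of bounded variation there is $g\in L^1(\mu;G)$ with $\nu(A)=\int_Ag\,\mathrm d\mu$ for all $A\in\mathcal A$. *)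

(* Defs.v *)
From HB Require Import structures.
From mathcomp Require Import all_boot all_order all_algebra.
From mathcomp Require Import all_classical all_reals all_analysis.

Set Implicit Arguments.
Unset Strict Implicit.
Unset Printing Implicit Defensive.

Import Order.TTheory GRing.Theory Num.Theory.
Import numFieldNormedType.Exports.

Local Open Scope classical_set_scope.
Local Open Scope ring_scope.

(* Paths on R_{>=0} are total functions R -> V; only their values at times
   t >= 0 are ever used. *)
Section paths.
Context {R : realType} {V : normedModType R}.
Implicit Types (X A : R -> V) (t : R).

Definition cadlag X :=
  (forall t : R, 0 <= t -> X @ t^'+ --> X t) /\
  (forall t : R, 0 < t -> cvg (X @ t^'-)).

Definition jump X t : V := if 0 < t then X t - lim (X @ t^'-) else 0.

(* The library's [variation] is restricted to real-valued functions. *)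
Definition path_variation A t : \bar R :=
  ereal_sup [set (let F := A \o nth t (0 :: s) in
                  \sum_(0 <= n < size s) `|F n.+1 - F n|)%:E
            | s in itv_partition 0 t].

Definition finite_variation A :=
  forall t : R, 0 <= t -> (path_variation A t < +oo)%E.

End paths.

(* The partition { ]t_i, t_{i+1}] : i } is given by the sequence (t_i). *)
Record time_partition (R : realType) := TimePartition {
  ppoint :> nat -> R ;
  _ : ppoint 0%N = 0 ;
  _ : forall i, ppoint i < ppoint i.+1 ;
  _ : ppoint @ \oo --> +oo }.

Section partitions.
Context {R : realType}.
Implicit Types (p : time_partition R) (t : R).

Definition pitv p (i : nat) : set R := `]p i, p i.+1]%classic.

(* Index of the interval of p that contains t, for t > 0. *)
Definition pindex p t : nat := xget 0%N [set i | pitv p i t].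

Definition increment {V : normedModType R} (X : R -> V) p t i : V :=
  X (Num.min (p i.+1) t) - X (Num.min (p i) t).

End partitions.

Section bilinear_maps.
Context {R : realType} {E G : normedModType R}.
Implicit Type B : {bilinear E -> E -> G}.

Definition bounded_bilinear B :=
  exists M : R, forall x y, `|B x y| <= M * (`|x| * `|y|).

Definition bilinear_norm B : R :=
  sup [set `|B z.1 z.2| | z in [set z : E * E | `|z.1| <= 1 /\ `|z.2| <= 1]].

End bilinear_maps.

Definition weak_cvg {R : realType} {G : normedModType R}
    (u : nat -> G) (l : G) :=
  forall phi : {linear G -> R^o}, continuous phi ->
    phi \o u @ \oo --> phi l.

Record increasing_path (R : realType) := IncreasingPath {
  ipath :> R -> R ;
  ipath_cadlag : cadlag ipath ;
  ipath_incr : forall s t : R, 0 <= s -> s <= t -> ipath s <= ipath t }.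

Section quadratic_variation.
Context {R : realType} {E G : normedModType R}.
Implicit Types (pi : nat -> time_partition R) (X : R -> E).

(* The sums over I in pi_n are finitely supported, since the increments
   delta X_t(I) vanish for all I = ]r, s] with r >= t. *)
Definition weak_quadratic_variation (B : {bilinear E -> E -> G}) pi X
    (QB : R -> G) :=
  [/\ cadlag QB, finite_variation QB,
    forall t : R, 0 <= t ->
      weak_cvg (fun n => \sum_(i \in [set: nat])
        B (increment X (pi n) t i) (increment X (pi n) t i)) (QB t) &
    forall t : R, 0 <= t -> jump QB t = B (jump X t) (jump X t)].

Definition scalar_quadratic_variation pi X (Q : increasing_path R) :=
  (forall t : R, 0 <= t ->
    (fun n => \sum_(i \in [set: nat]) `|increment X (pi n) t i| ^+ 2) @ \oo
      --> Q t) /\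
  (forall t : R, 0 <= t -> jump Q t = `|jump X t| ^+ 2).

End quadratic_variation.

Section condition_C.
Context {R : realType} {E : normedModType R}.
Implicit Types (pi : nat -> time_partition R) (X Z : R -> E).

Definition jump_times X : set R := [set t | jump X t != 0].

Definition big_jump_times X (eps : R) : set R := [set t | eps < `|jump X t|].

Definition big_jumps X (eps : R) (t : R) : E :=
  \sum_(s \in `]0, t] `&` big_jump_times X eps) jump X s.

(* Adjoining 0 gives the supremum over the empty family (t = 0) its value 0
   instead of -oo; it does not change the supremum otherwise. *)
Definition oscillation Z (p : time_partition R) (t : R) : \bar R :=
  ereal_sup ([set 0%E] `|`
    [set e | exists i u v, [/\ (pitv p i `&` `[0, t]) u,
       (pitv p i `&` `[0, t]) v & e = (`|Z u - Z v|%R)%:E]]).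

Definition condition_C1 pi X :=
  forall t eps : R, 0 <= t -> 0 < eps -> exists N, forall n i, (N <= n)%N ->
    is_subset1 (pitv (pi n) i `&` `[0, t] `&` big_jump_times X eps).

Definition condition_C2 pi X :=
  forall s t : R, jump_times X s -> s <= t ->
    (fun n => increment X (pi n) t (pindex (pi n) s)) @ \oo --> jump X s.

Definition condition_C3 pi X :=
  forall t : R, 0 <= t ->
    limf_esup (fun eps : R =>
      limn_esup (fun n => oscillation (X \- big_jumps X eps) (pi n) t))
      (0 : R)^'+ = 0%E.

Definition condition_C pi X :=
  [/\ condition_C1 pi X, condition_C2 pi X & condition_C3 pi X].

End condition_C.

Section bochner.
Context {d : measure_display} {T : measurableType d} {R : realType}
  {G : normedModType R}.
Implicit Types (mu : {measure set T -> \bar R}) (D : set T) (f : T -> G).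

Definition simple_fun (s : T -> G) :=
  finite_set (range s) /\ forall y, measurable (s @^-1` [set y]).

Definition integrable_simple mu D (s : T -> G) :=
  simple_fun s /\
  forall y, y != 0 -> (mu (D `&` s @^-1` [set y]) < +oo)%E.

Definition simple_integral mu D (s : T -> G) : G :=
  \sum_(y \in range s) fine (mu (D `&` s @^-1` [set y])) *: y.

(* Every mu-a.e. class of mu-a.e. limits of simple functions contains a
   function that is an everywhere limit of simple functions. *)
Definition strongly_measurable D f :=
  exists s : nat -> T -> G, (forall n, simple_fun (s n)) /\
    forall x, D x -> s ^~ x @ \oo --> f x.

Definition bochner_approx mu D f (s : nat -> T -> G) :=
  (forall n, integrable_simple mu D (s n)) /\
  (fun n => \int[mu]_(x in D) (`|f x - s n x|%R)%:E)%E @ \oo --> 0%E.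

Definition bochner_integrable mu D f :=
  strongly_measurable D f /\ exists s, bochner_approx mu D f s.

(* The limit of the integrals of approximating integrable simple functions;
   it does not depend on the approximating sequence. *)
Definition bochner_integral mu D f : G :=
  xget 0 [set v | exists2 s, bochner_approx mu D f s &
                  (fun n => simple_integral mu D (s n)) @ \oo --> v].

End bochner.

Section vector_measures.
Context {d : measure_display} {T : measurableType d} {R : realType}
  {G : normedModType R}.
Implicit Type nu : set T -> G.

Definition vector_measure nu :=
  forall F : nat -> set T, (forall i, measurable (F i)) -> trivIset setT F ->
    (fun n => \sum_(0 <= i < n) nu (F i)) @ \oo --> nu (\bigcup_i F i).

Definition vm_bounded_variation nu :=
  exists M : R, forall (n : nat) (F : nat -> set T),
    (forall i, measurable (F i)) -> trivIset setT F ->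
    \sum_(0 <= i < n) `|nu (F i)| <= M.

Definition vm_abs_continuous nu (mu : {measure set T -> \bar R}) :=
  forall A, measurable A -> mu A = 0%E -> nu A = 0.

End vector_measures.

Definition radon_nikodym_property (R : realType) (G : normedModType R) :=
  forall (d : measure_display) (T : measurableType d)
    (mu : {finite_measure set T -> \bar R}) (nu : set T -> G),
    vector_measure nu -> vm_bounded_variation nu -> vm_abs_continuous nu mu ->
    exists2 g : T -> G, bochner_integrable mu setT g &
      forall A, measurable A -> nu A = bochner_integral mu A g.

(* The Stieltjes measure dQ of a path Q on R_{>=0}, extended to R by Q 0 on the
   negative half-line so that dQ does not charge ]-oo, 0]. *)
Section stieltjes.
Context {R : realType}.
Variable Q : increasing_path R.

Definition path_extension (t : R) : R := Q (Num.max 0 t).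

Lemma path_extension_nondecreasing : nondecreasing path_extension.
Proof.
move=> s t st; apply: ipath_incr; first by rewrite le_max lexx.
by rewrite ge_max le_max lexx/= le_max st orbT.
Qed.

Lemma path_extension_right_continuous : right_continuous path_extension.
Proof.
move=> t; rewrite /path_extension; case: (boolP (t < 0)) => [t0|].
  rewrite (max_l (ltW t0)).
  apply: (@cvg_trans _ ((fun=> Q 0) @ t^'+)); last exact: cvg_cst.
  apply: near_eq_cvg; near=> s.
  by rewrite max_l//; near: s; exact: nbhs_right_le.
rewrite -leNgt => t0; rewrite (max_r t0).
apply: (@cvg_trans _ (Q @ t^'+)); last exact: (ipath_cadlag Q).1.
apply: near_eq_cvg; near=> s; rewrite max_r//.
by rewrite (le_trans t0).
Unshelve. all: by end_near. Qed.

HB.instance Definition _ := isCumulative.Build R _ R path_extension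
  path_extension_nondecreasing path_extension_right_continuous.

Definition path_measure : {measure set (measurableTypeR R) -> \bar R} :=
  lebesgue_stieltjes_measure path_extension.

Definition L1_loc {G : normedModType R} (q : R -> G) :=
  forall t : R, 0 <= t -> bochner_integrable path_measure `[0, t]%classic q.

End stieltjes.

(* Main.v *)
Require Import Defs.
From HB Require Import structures.
From mathcomp Require Import all_boot all_order all_algebra finmap.
From mathcomp Require Import all_classical all_reals all_analysis.
From mathcomp Require Import measurable_realfun ring lra.

Set Implicit Arguments.
Unset Strict Implicit.
Unset Printing Implicit Defensive.

Import Order.TTheory GRing.Theory Num.Theory.
Import numFieldNormedType.Exports.

Local Open Scope classical_set_scope.
Local Open Scope ring_scope.

(* The increments of Q_B are controlled by those of Q: for 0 <= s <= t,
     |Q_B(t) - Q_B(s)| <= |B| (Q(t) - Q(s)).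
   Tested against a functional of norm at most 1, the two sums over pi_n at
   times s and t can be compared term by term, up to an error |a||b| where
   a + b is the increment over the interval straddling s, cut at s. By (C1)
   that interval contains at most one big jump, so by (C3) one of a, b is
   small, while both are bounded because the sums of squares converge.

   Hence the variation V of Q_B is right-continuous and dV <= |B| dQ. For every
   functional phi of norm at most 1, V + phi o Q_B is nondecreasing; the scalar
   measures it defines determine, by a pi-lambda argument, a vector measure nu
   with |nu(A)| <= dV(A). On each ]k, k+1] the Radon-Nikodym property gives a
   density g of nu, and |nu| <= dV forces |g| dQ <= dV, which yields both the
   bound by |B| and one half of the variation formula. *)

(** * Norming functionals *)

(** The vector measure cannot be built from [QB] directly, since only nondecreasing real functions
    carry a Stieltjes measure here. Adding [V] makes every tested path nondecreasing, and the
    relation m_F(A) = m_V(A) + phi(v) that ties a vector v to a set A survives complements and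
    disjoint unions, completeness of G providing the sum. All vector identities, those of the
    Bochner integral included, are reduced to real ones by functionals of norm at most 1; that these
    separate points and attain norms is the only duality used. Comparing nu with dV, and not just
    with |B| dQ, is what keeps the variation formula sharp. The half V <= int |q| dQ has another
    source: the increments of Q_B are Bochner integrals of q, hence dominated by the increments of
    int |q| dQ. The unit blocks appear because the Radon-Nikodym property concerns finite measures,
    whereas dQ may have infinite mass. *)

Section hahn_banach.
Context {R : realType} {G : normedModType R}.
Implicit Types (x y : G) (a r : R) (S : set (G * R)).

(** Graph of a partial linear functional below the norm, as a set of pairs (vector, value).
    Single-valuedness is automatic: subtracting (x, s) from (x, r) leaves (0, r - s), so r <= s, and
    symmetrically. The empty set qualifies too, hence the hypothesis [S (0, 0)] of the extension
    step. *)
Definition dominated_linear S :=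
  (forall a p q, S p -> S q -> S (a *: p.1 + q.1, a * p.2 + q.2)) /\
  (forall p, S p -> p.2 <= `|p.1|).

Lemma dominated_linear_line v :
  dominated_linear [set p | exists a, p = (a *: v, a * `|v|)].
Proof.
split=> [a p q [b ->] [c ->]|p [a ->]] /=.
  by exists (a * b + c); rewrite scalerDl scalerA mulrDl mulrA.
by rewrite normrZ ler_wpM2r// ler_norm.
Qed.

(** The one-dimensional Hahn-Banach step: the value [c] at [x] must lie above all p.2 - |p.1 - x|
    and below all |q.1 + x| - q.2. The triangle inequality puts each lower bound below each upper
    bound, so the supremum of the lower ones works. *)
Lemma dominated_linear_extend S x : S (0, 0) -> dominated_linear S ->
  exists c, dominated_linear [set p | exists a q, S q /\
    p = (q.1 + a *: x, q.2 + a * c)].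
Proof.
move=> S0 [linS domS].
have linN p : S p -> S (- p.1, - p.2).
  by move=> Sp; have := linS (-1) _ _ Sp S0; rewrite /= !addr0 scaleN1r mulN1r.
have linD p q : S p -> S q -> S (p.1 + q.1, p.2 + q.2).
  by move=> Sp Sq; have := linS 1 _ _ Sp Sq; rewrite scale1r mul1r.
have linZ a p : S p -> S (a *: p.1, a * p.2).
  by move=> Sp; have := linS a _ _ Sp S0; rewrite /= !addr0.
pose L := [set p.2 - `|p.1 - x| | p in S].
have LU p q : S p -> S q -> p.2 - `|p.1 - x| <= `|q.1 + x| - q.2.
  move=> Sp Sq; rewrite lerBlDr addrAC lerBrDr.
  apply: (le_trans (domS _ (linD _ _ Sp Sq))) => /=.
  apply: le_trans (ler_normD _ _).
  by rewrite addrACA subrr addr0 addrC.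
have L0 : L !=set0 by exists (0 - `|0 - x|); exists (0, 0).
have Lub : has_sup L.
  split => //; exists (`|0 + x| - 0) => _ [p Sp <-].
  by have := LU _ _ Sp S0; apply.
pose c := sup L; exists c.
have cl p : S p -> p.2 - `|p.1 - x| <= c.
  by move=> Sp; apply: (ub_le_sup Lub.2); exists p.
have cu p : S p -> c <= `|p.1 + x| - p.2.
  by move=> Sp; apply: ge_sup => // _ [q Sq <-]; exact: LU.
split.
  move=> a _ _ [b [p [Sp ->]]] [d [q [Sq ->]]] /=.
  exists (a * b + d), (a *: p.1 + q.1, a * p.2 + q.2); split; first exact: linS.
  congr pair => /=.
    by rewrite scalerDr scalerA scalerDl addrACA.
  by ring.
move=> _ [a [q [Sq ->]]] /=.
(* Dividing by |a| reduces a > 0 to the upper bound on [c] and a < 0 to the lower bound. *)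
have [a0|a0|->] := ltgtP a 0; last first.
- by rewrite scale0r mul0r !addr0 domS.
- have := cu _ (linZ a^-1 _ Sq); rewrite /= lerBrDr -(ler_pM2l a0) mulrDr.
  rewrite mulVKf ?gt_eqF// addrC => /le_trans; apply.
  rewrite -[X in X * _](gtr0_norm a0) -normrZ scalerDr scalerA divff ?gt_eqF//.
  by rewrite scale1r.
- have na0 : 0 < - a by rewrite oppr_gt0.
  have := cl _ (linZ (- a)^-1 _ Sq).
  rewrite /= lerBlDr -(ler_pM2l na0) mulVKf ?gt_eqF// mulrDr mulNr.
  rewrite -lerBlDl opprK => /le_trans; apply.
  rewrite -[X in X * _](gtr0_norm na0) -normrZ scalerBr scalerA divff ?gt_eqF//.
  by rewrite scale1r scaleNr opprK.
Qed.

Lemma norming_functional v :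
  exists phi : {linear G -> R^o}, phi v = `|v| /\ forall x, `|phi x| <= `|x|.
Proof.
pose g0 : set (G * R) := [set p | exists a, p = (a *: v, a * `|v|)].
(* The line through [v] is adjoined inside the property instead of being required of [S], so that
   the union of an empty chain still satisfies it. *)
pose P S := dominated_linear (S `|` g0).
have P0 : P set0 by rewrite /P set0U; exact: dominated_linear_line.
have [S [[linS domS] maxS]] : exists S, P S /\ forall S', S `<` S' -> ~ P S'.
  apply: Zorn_bigcup => F FP totF.
  have [[X0 FX0]|F0] := pselect (F !=set0); last first.
    suff -> : \bigcup_(X in F) X = set0 by [].
    by apply: bigcup0 => X FX; exfalso; apply: F0; exists X.
  have memU p : ((\bigcup_(X in F) X) `|` g0) p -> exists2 X, F X & (X `|` g0) p.
    by move=> [[X FX Xp]|gp]; [exists X => //; left|exists X0 => //; right].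
  have Umem X p : F X -> (X `|` g0) p -> ((\bigcup_(X in F) X) `|` g0) p.
    by move=> FX [Xp|gp]; [left; exists X|right].
  split=> [a p q /memU[X FX Xp] /memU[Y FY Yq]|p /memU[X FX Xp]]; last first.
    exact: (FP _ FX).2.
  have [XY|YX] := totF _ _ FX FY.
    by apply: (Umem _ _ FY); apply: (FP _ FY).1 => //; case: Xp => [/XY|]; [left|right].
  by apply: (Umem _ _ FX); apply: (FP _ FX).1 => //; case: Yq => [/YX|]; [left|right].
pose D := S `|` g0.
have D0 : D (0, 0) by right; exists 0; rewrite scale0r mul0r.
have total x : exists r, D (x, r).
  have [c [linE domE]] := dominated_linear_extend x D0 (conj linS domS).
  set E := [set p | _] in linE domE.
  have DE : D `<=` E.
    by move=> [y r] Dp; exists 0, (y, r); rewrite scale0r mul0r !addr0.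
  have Exc : E (x, c).
    by exists 1, (0, 0); rewrite scale1r mul1r !add0r.
  have EU : E `|` g0 = E.
    by apply/setUidPl; apply: subset_trans DE; exact: subsetUr.
  (* Were there no pair over [x] in [D], the extension [E] would be strictly larger than [S] and
     still admissible. *)
  apply: contrapT => nx; apply: (maxS E); last by rewrite /P EU.
  split; first by apply: subset_trans DE; exact: subsetUl.
  by move=> ES; apply: nx; exists c; left; exact: ES.
have fct x r s : D (x, r) -> D (x, s) -> r = s.
  suff le r' s' : D (x, r') -> D (x, s') -> r' <= s'.
    by move=> Dr Ds; apply/eqP; rewrite eq_le !le.
  move=> Dr Ds; have := domS _ (linS (-1) _ _ Ds Dr).
  by rewrite /= scaleN1r addNr normr0 mulN1r addrC subr_le0.
pose f x : R^o := xget 0 [set r | D (x, r)].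
have fD x : D (x, f x) := xgetPex (0 : R^o) (total x).
have flin : linear f.
  by move=> a x y; apply: fct (fD _) _; exact: (linS a _ _ (fD x) (fD y)).
pose phi : {linear G -> R^o} := HB.pack f (GRing.isLinear.Build _ _ _ _ f flin).
exists phi; split=> [|x].
  by apply: fct (fD _) _; right; exists 1; rewrite scale1r mul1r.
rewrite ler_norml; apply/andP; split; last exact: (domS _ (fD x)).
by rewrite lerNl -normrN -(linearN phi); exact: (domS _ (fD (- x))).
Qed.

Lemma eq_unit_functional x y :
  (forall phi : {linear G -> R^o}, (forall z, `|phi z| <= `|z|) ->
    phi x = phi y) -> x = y.
Proof.
move=> xy; have [phi [phiE phi1]] := norming_functional (x - y).
by apply/eqP; rewrite -subr_eq0 -normr_eq0 -phiE linearB xy// subrr.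
Qed.

(** One-sided estimates suffice because some functional attains the norm; upper bounds can thus be
    used without absolute values. *)
Lemma norm_le_unit_functional x r :
  (forall phi : {linear G -> R^o}, (forall z, `|phi z| <= `|z|) ->
    phi x <= r) -> `|x| <= r.
Proof. by have [phi [<- phi1]] := norming_functional x; apply. Qed.

Lemma unit_functional_continuous (phi : {linear G -> R^o}) :
  (forall z, `|phi z| <= `|z|) -> continuous phi.
Proof.
move=> phi1; apply/linear_bounded_continuous.
apply/linear_boundedP; exists 1; split=> // c c1 x.
by rewrite (le_trans (phi1 x))// ler_peMl// ltW.
Qed.

End hahn_banach.

(** * Increments along partitions *)

Section bilinear_estimates.
Context {R : realType} {E G : normedModType R} (B : {bilinear E -> E -> G}).
Hypothesis bB : bounded_bilinear B.
Implicit Types x y a c : E.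

Let bilinear_norm_has_ubound :
  has_ubound [set `|B z.1 z.2| | z in [set z : E * E | `|z.1| <= 1 /\ `|z.2| <= 1]].
Proof.
have [M BM] := bB; exists `|M| => _ [[x y] /= [x1 y1] <-].
apply: (le_trans (BM x y)); apply: (@le_trans _ _ (`|M| * (`|x| * `|y|))).
  by rewrite ler_wpM2r ?mulr_ge0// ler_norm.
by rewrite ler_piMr// mulr_ile1.
Qed.

Lemma bilinear_norm_ge0 : 0 <= bilinear_norm B.
Proof.
apply: le_trans (normr_ge0 (B 0 0)) _.
by apply: (ub_le_sup bilinear_norm_has_ubound); exists (0, 0); rewrite //= normr0.
Qed.

Lemma norm_bilinear_le x y : `|B x y| <= bilinear_norm B * (`|x| * `|y|).
Proof.
have [->|x0] := eqVneq x 0; first by rewrite linear0l !normr0 mul0r mulr0.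
have [->|y0] := eqVneq y 0; first by rewrite linear0r !normr0 !mulr0.
have -> : B x y = (`|x| * `|y|) *: B (`|x|^-1 *: x) (`|y|^-1 *: y).
  rewrite linearZl linearZr /= !scalerA [X in X *: _](_ : _ = 1) ?scale1r//.
  by field; rewrite !normr_eq0 x0 y0.
rewrite normrZ normrM !normr_id mulrC ler_wpM2r ?mulr_ge0//.
apply: (ub_le_sup bilinear_norm_has_ubound).
exists (`|x|^-1 *: x, `|y|^-1 *: y) => //=.
by rewrite !normrZ !normfV !normr_id !mulVf ?normr_eq0.
Qed.

(** With b = c - a the left side is phi of B(a,b) + B(b,a) + B(b,b), at most |B| (2|a||b| + |b|^2).
    Squaring ||a| - |b|| <= |c| gives |b|^2 <= |c|^2 - |a|^2 + 2|a||b|, whence the constant 4. *)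
Lemma bilinear_square_increment_le (phi : {linear G -> R^o}) a c :
  (forall z, `|phi z| <= `|z|) ->
  phi (B c c) - phi (B a a) <= bilinear_norm B *
    (`|c| ^+ 2 - `|a| ^+ 2 + 4 * (`|a| * `|c - a|)).
Proof.
move=> phi1; set b := c - a.
have cE : c = a + b by rewrite addrC subrK.
clearbody b; rewrite {}cE.
have -> : phi (B (a + b) (a + b)) - phi (B a a) =
    phi (B a b) + phi (B b a) + phi (B b b).
  rewrite -linearB -!linearD; congr (phi _).
  by rewrite linearDl !linearDr/= addrC !addrA addNr add0r.
have phiB x y : phi (B x y) <= bilinear_norm B * (`|x| * `|y|).
  by rewrite (le_trans (ler_norm _))// (le_trans (phi1 _))// norm_bilinear_le.
apply: (@le_trans _ _ (bilinear_norm B * (2 * (`|a| * `|b|) + `|b| ^+ 2))).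
  by have := phiB a b; have := phiB b a; have := phiB b b; lra.
rewrite ler_wpM2l ?bilinear_norm_ge0//.
have bac : `|b| <= `|a + b| + `|a|.
  by rewrite -[X in `|X| <= _](addKr a) addrC ler_normB.
have abc : `|a| <= `|a + b| + `|b| by rewrite -[X in `|X| <= _](addrK b) ler_normB.
have := normr_ge0 a; have := normr_ge0 b; have := normr_ge0 c; nra.
Qed.

End bilinear_estimates.

Section time_partitions.
Context {R : realType} (p : time_partition R).

Lemma ppoint0 : p 0%N = 0. Proof. by case: p. Qed.

Lemma ppoint_ltS i : p i < p i.+1. Proof. by case: p. Qed.

Lemma ppoint_le : {homo p : i j / (i <= j)%N >-> i <= j}.
Proof. by apply: homo_leq => //; [exact: le_trans|move=> i; exact/ltW/ppoint_ltS]. Qed.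

Lemma ppoint_ge0 i : 0 <= p i.
Proof. by rewrite -ppoint0 ppoint_le. Qed.

Lemma ppoint_unbounded (t : R) : exists N, forall i, (N <= i)%N -> t <= p i.
Proof.
have /cvgryPge/(_ t)[N _ Np] : p @ \oo --> +oo by case: p.
by exists N => i Ni; exact: Np.
Qed.

End time_partitions.

Section increments.
Context {R : realType} {V : normedModType R} (X : R -> V) (p : time_partition R).

Lemma increment_stable s t i : s <= t -> p i.+1 <= s ->
  increment X p t i = increment X p s i.
Proof.
move=> st ps; have ps' : p i <= s by rewrite (le_trans _ ps)// ltW// ppoint_ltS.
by rewrite /increment !min_l// ?(le_trans _ st).
Qed.

Lemma increment_eq0 t i : t <= p i -> increment X p t i = 0.
Proof.
move=> tp; rewrite /increment !min_r ?subrr//.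
by rewrite (le_trans tp)// ltW// ppoint_ltS.
Qed.

Lemma increment_fsbig (W : zmodType) (f : V -> W) (t : R) N : f 0 = 0 ->
  (forall i, (N <= i)%N -> t <= p i) ->
  \sum_(i \in [set: nat]) f (increment X p t i) =
  \sum_(i < N) f (increment X p t i).
Proof.
move=> f0 Np; rewrite (fsbig_ord _ N (fun i => f (increment X p t i))).
apply/esym/fsbig_widen => // i [_ /= /negP]; rewrite -leqNgt => Ni.
by rewrite increment_eq0// Np.
Qed.

End increments.

Section oscillation_control.
Context {R : realType} {E : normedModType R} (X : R -> E).

(** Both upper limits are infima of suprema, so a value below [eta] is already reached at a single
    [eps] and for all [n] from some index on. *)
Lemma condition_C3_small (pi : nat -> time_partition R) (t eta : R) :
  condition_C3 pi X -> 0 <= t -> 0 < eta ->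
  exists2 eps : R, 0 < eps & exists N, forall n, (N <= n)%N ->
    (oscillation (X \- big_jumps X eps)%R (pi n) t < eta%:E)%E.
Proof.
move=> C3 t0 eta0.
have : (limf_esup (fun eps : R =>
    limn_esup (fun n => oscillation (X \- big_jumps X eps)%R (pi n) t))
    (0 : R)^'+ < eta%:E)%E by rewrite C3// lte_fin.
move=> /ereal_inf_lt[_ [A A0 <-] supA].
have [eps [eps0 Aeps]] : exists eps, 0 < eps /\ A eps.
  have : \forall x \near (0:R)^'+, 0 < x /\ A x.
    by near=> x; split; [near: x; exact: nbhs_right_gt|near: x; exact: A0].
  by move=> /filter_ex.
exists eps => //.
have : (limn_esup (fun n => oscillation (X \- big_jumps X eps)%R (pi n) t)
    < eta%:E)%E.
  by apply: le_lt_trans supA; apply: ereal_sup_ubound; exists eps.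
move=> /ereal_inf_lt[_ [C [N _ NC] <-] supC].
exists N => n Nn; apply: le_lt_trans supC; apply: ereal_sup_ubound.
by exists n => //; exact: NC.
Unshelve. all: by end_near. Qed.

(* The interval of the partition that contains s has at most one big jump, so
   X - J_eps = X + const on one of its two parts cut at s. *)
Lemma straddling_increment_small (p : time_partition R) (s t eps eta : R) i :
  cadlag X -> 0 <= s -> s <= t -> p i < s ->
  s < p i.+1 ->
  is_subset1 (pitv p i `&` `[0, t] `&` big_jump_times X eps) ->
  (oscillation (X \- big_jumps X eps)%R p t < eta%:E)%E ->
  `|increment X p s i| <= eta \/
  `|increment X p t i - increment X p s i| <= eta.
Proof.
move=> [rcX _] s0 st ps sp one osc.
(* Without a big jump in ]u, v] the path J_eps takes equal values at [u] and [v], so the increment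
   of [X] is that of X - J_eps, which the oscillation controls. *)
have small u v : p i < u -> u <= v -> v <= p i.+1 -> v <= t ->
    `]u, v] `&` big_jump_times X eps = set0 -> `|X v - X u| <= eta.
  move=> pu uv vp vt nojump.
  have J : big_jumps X eps u = big_jumps X eps v.
    rewrite /big_jumps; congr (\sum_(x \in _) _).
    have u0 : 0 <= u by exact: le_trans (ppoint_ge0 p i) (ltW _).
    rewrite (_ : `]0, v] = `]0, u] `|` `]u, v])%classic.
      by rewrite setIUl nojump setU0.
    by rewrite -itv_bndbnd_setU ?bnd_simp.
  rewrite -lee_fin; apply/ltW; apply: le_lt_trans osc.
  apply: ereal_sup_ubound; right; exists i, v, u; split.
  - rewrite /pitv /= !in_itv/= vt vp (lt_le_trans pu)//.
    by rewrite (le_trans (ltW (le_lt_trans (ppoint_ge0 p i) pu))).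
  - rewrite /pitv /= !in_itv/= (le_trans uv vt) (le_trans uv vp) pu ltW//.
    exact: le_lt_trans (ppoint_ge0 p i) pu.
  - by rewrite /= J opprB addrA subrK.
rewrite /increment (min_l (ltW ps)) (min_r (ltW sp)).
rewrite (min_l (ltW (lt_le_trans ps st))) opprB addrA subrK.
set u := Num.min _ _.
have su : s <= u by rewrite le_min st (ltW sp).
(* A big jump in ]p i, s] is the only one of the whole interval, which leaves none in ]s, u]. *)
have [[j [/= psj jX]]|nojump] := pselect ((`]p i, s] `&` big_jump_times X eps) !=set0).
  right; apply: small => //; rewrite ?ge_min ?lexx ?orbT//.
  rewrite -subset0 => k [/=]; rewrite in_itv/= => /andP[sk ku] kX.
  move: psj; rewrite in_itv/= => /andP[pj js].
  have kp : k <= p i.+1 by rewrite (le_trans ku)// ge_min lexx.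
  have kt : k <= t by rewrite (le_trans ku)// ge_min lexx orbT.
  have j0 : 0 <= j by exact: le_trans (ppoint_ge0 p i) (ltW _).
  suff jk : j = k by move: sk; rewrite -jk ltNge js.
  apply: one; split => //; rewrite /pitv /= !in_itv/=; split; apply/andP; split => //.
  - by rewrite (le_trans js)// ltW.
  - by rewrite (le_trans js).
  - exact: lt_trans sk.
  - by rewrite ltW// (le_lt_trans s0 sk).
(* The left end [p i] is outside the half-open interval seen by the oscillation; it is replaced by a
   point r > p i, at a cost of at most [e] by right continuity. *)
left; apply/ler_addgt0Pr => e e0.
have : \forall r \near (p i)^'+, p i < r /\ r < s /\ `|X (p i) - X r| <= e.
  near=> r; split; first by near: r; exact: nbhs_right_gt.
  split; first by near: r; exact: nbhs_right_lt.
  by near: r; move: (e) e0; apply/cvgrPdist_le; exact: rcX (ppoint_ge0 p i).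
move=> /filter_ex[r [pr [rs Xr]]].
rewrite -(subrKA (X r)) (le_trans (ler_normD _ _))// lerD//; last by rewrite distrC.
apply: small => //; [exact: ltW|exact: ltW|].
rewrite -subset0 => k [/=]; rewrite in_itv/= => /andP[rk ks] kX.
by apply: nojump; exists k; split => //=; rewrite in_itv/= ks (lt_trans pr).
Unshelve. all: by end_near. Qed.

End oscillation_control.

(** * Comparison of the increments of Q_B with those of Q *)

Section quadratic_variation_lipschitz.
Context {R : realType} {E G : normedModType R} (B : {bilinear E -> E -> G})
  (X : R -> E).
Hypotheses (bB : bounded_bilinear B) (cX : cadlag X).

(** A term survives only if [s] is interior to its interval: intervals ending by [s] have equal
    increments at both times, those starting at [s] or later have increment 0 at time [s]. In the
    surviving term one factor is at most [eta]; the other is bounded by squares through x <= 1 +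
    x^2. *)
Lemma sum_straddling_le (p : time_partition R) (s t eps eta : R) N :
  0 <= s -> s <= t -> 0 <= eta ->
  (forall i, is_subset1 (pitv p i `&` `[0, t] `&` big_jump_times X eps)) ->
  (oscillation (X \- big_jumps X eps)%R p t < eta%:E)%E ->
  \sum_(i < N) `|increment X p s i| * `|increment X p t i - increment X p s i|
  <= eta * (3 + 2 * \sum_(i < N) `|increment X p s i| ^+ 2 +
                \sum_(i < N) `|increment X p t i| ^+ 2).
Proof.
move=> s0 st eta0 one osc.
have [[i /andP[pis spi]]|none] :=
    pselect (exists i : 'I_N, p i < s < p i.+1).
  rewrite (bigD1 i)//= [X in _ + X <= _]big1 => [|j ji].
    rewrite addr0.
    have := straddling_increment_small cX s0 st pis spi (one i) osc.
    set a := increment X p s i; set c := increment X p t i => small.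
    have bac : `|c - a| <= `|c| + `|a| := ler_normB c a.
    apply: (@le_trans _ _ (eta * (3 + 2 * `|a| ^+ 2 + `|c| ^+ 2))); last first.
      by rewrite ler_wpM2l// lerD// ?lerD2l ?ler_pM2l// (bigD1 i)//= lerDl sumr_ge0.
    have a0 := normr_ge0 a; have b0 := normr_ge0 (c - a); have c0 := normr_ge0 c.
    have sq (x : R) : x <= 1 + x ^+ 2 by have := sqr_ge0 (x - 1); rewrite sqrrB1; nra.
    have sqa := sq `|a|; have sqc := sq `|c|; have a2 := sqr_ge0 `|a|.
    have c2 := sqr_ge0 `|c|; case: small => small.
      apply: (@le_trans _ _ (eta * `|c - a|)); first by rewrite ler_wpM2r.
      by rewrite ler_wpM2l//; lra.
    rewrite mulrC; apply: (@le_trans _ _ (eta * `|a|)); first by rewrite ler_wpM2r.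
    by rewrite ler_wpM2l//; lra.
  have := ji; rewrite -val_eqE/= neq_ltn => /orP[lt_ji|lt_ij].
    rewrite (increment_stable _ st) ?subrr ?normr0 ?mulr0//.
    by rewrite (le_trans (ppoint_le p lt_ji))// ltW.
  rewrite (@increment_eq0 _ _ X p s) ?normr0 ?mul0r//.
  by rewrite (le_trans (ltW spi))// ppoint_le.
rewrite big1 => [|i _].
  by rewrite mulr_ge0// !addr_ge0// ?mulr_ge0// sumr_ge0.
have [spi|pis] := leP s (p i).
  by rewrite (increment_eq0 _ spi) normr0 mul0r.
rewrite (increment_stable _ st) ?subrr ?normr0 ?mulr0// leNgt.
by apply/negP => spi; apply: none; exists i; rewrite pis.
Qed.

Lemma quadratic_variation_lipschitz (pi : nat -> time_partition R)
    (QB : R -> G) (Q : R -> R) (s t : R) :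
  (forall t : R, 0 <= t ->
      weak_cvg (fun n => \sum_(i \in [set: nat])
        B (increment X (pi n) t i) (increment X (pi n) t i)) (QB t)) ->
  (forall t : R, 0 <= t ->
    (fun n => \sum_(i \in [set: nat]) `|increment X (pi n) t i| ^+ 2) @ \oo
      --> Q t) ->
  condition_C1 pi X -> condition_C3 pi X -> 0 <= s -> s <= t ->
  `|QB t - QB s| <= bilinear_norm B * (Q t - Q s).
Proof.
move=> cvgQB cvgQ C1 C3 s0 st; have t0 := le_trans s0 st.
have K0 := bilinear_norm_ge0 bB; set K := bilinear_norm B in K0 *.
apply: norm_le_unit_functional => phi phi1; rewrite linearB.
have cphi := unit_functional_continuous phi1.
set Sn := fun u n => \sum_(i \in [set: nat])
  B (increment X (pi n) u i) (increment X (pi n) u i).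
set Qn := fun u n => \sum_(i \in [set: nat]) `|increment X (pi n) u i| ^+ 2.
(* Here [eta] is fixed while [n] tends to infinity; it is made small only afterwards. *)
have bound eta : 0 < eta -> phi (QB t) - phi (QB s) <=
    K * (Q t - Q s + 4 * (eta * (3 + 2 * Q s + Q t))).
  move=> eta0.
  have [eps eps0 [N1 oscN]] := condition_C3_small C3 t0 eta0.
  have [N2 oneN] := C1 t eps t0 eps0.
  apply: (@ler_cvg_to _ \oo _ R (fun n => phi (Sn t n) - phi (Sn s n))
    (fun n => K * (Qn t n - Qn s n + 4 * (eta * (3 + 2 * Qn s n + Qn t n))))).
  - by apply: cvgB; exact: cvgQB.
  - apply: cvgMr; apply: cvgD; first by apply: cvgB; exact: cvgQ.
    apply: cvgMr; apply: cvgMr; apply: cvgD; last exact: cvgQ.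
    by apply: cvgD; [exact: cvg_cst|apply: cvgMr; exact: cvgQ].
  near=> n.
  (* From [N] on the partition points are at least [t], so the sums at both times become finite sums
     over the same indices. *)
  have [N Np] := ppoint_unbounded (pi n) t.
  have Np' i : (N <= i)%N -> s <= pi n i by move=> /Np; exact: le_trans.
  have osc : (oscillation (X \- big_jumps X eps)%R (pi n) t < eta%:E)%E.
    by apply: oscN; near: n; exact: nbhs_infty_ge.
  have one i : is_subset1 (pitv (pi n) i `&` `[0, t] `&` big_jump_times X eps).
    by apply: oneN; near: n; exact: nbhs_infty_ge.
  have := sum_straddling_le N s0 st (ltW eta0) one osc.
  rewrite /Sn /Qn.
  rewrite !(increment_fsbig _ (f := fun x => B x x) _ Np) ?linear0r//.
  rewrite !(increment_fsbig _ (f := fun x => B x x) _ Np') ?linear0r//.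
  rewrite !(increment_fsbig _ (f := fun x => `|x| ^+ 2) _ Np) ?normr0 ?expr0n//.
  rewrite !(increment_fsbig _ (f := fun x => `|x| ^+ 2) _ Np') ?normr0 ?expr0n//.
  move=> straddle.
  rewrite !(linear_sum phi) -sumrB.
  apply: (@le_trans _ _ (\sum_(i < N) K * (`|increment X (pi n) t i| ^+ 2 -
    `|increment X (pi n) s i| ^+ 2 + 4 * (`|increment X (pi n) s i| *
    `|increment X (pi n) t i - increment X (pi n) s i|)))).
    by apply: ler_sum => i _; exact: bilinear_square_increment_le.
  rewrite -mulr_sumr ler_wpM2l// big_split/= sumrB -mulr_sumr lerD2l.
  by rewrite ler_pM2l.
apply/ler_addgt0Pr => e e0.
(* Taking eta = e / D makes the error at most [e]; the summand 1 keeps [D] positive when [K] is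
   0. *)
pose D := 4 * K * (3 + 2 * `|Q s| + `|Q t|) + 1.
have D0 : 0 < D by rewrite ltr_wpDl// !mulr_ge0// !addr_ge0// mulr_ge0.
apply: (le_trans (bound (e / D) (divr_gt0 e0 D0))).
rewrite mulrDr lerD2l.
apply: (@le_trans _ _ (e / D * D)); last by rewrite divfK// gt_eqF.
have -> : K * (4 * (e / D * (3 + 2 * Q s + Q t))) =
    e / D * (4 * K * (3 + 2 * Q s + Q t)) by ring.
apply: ler_wpM2l; first by rewrite divr_ge0// ltW.
rewrite /D -[leLHS]addr0 lerD// ler_wpM2l ?mulr_ge0//.
by rewrite !lerD// ?ler_norm// ler_pM2l// ler_norm.
Unshelve. all: by end_near. Qed.

End quadratic_variation_lipschitz.

(** * Total variation and Stieltjes measures *)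

Section path_variation_theory.
Context {R : realType} {V : normedModType R} (A : R -> V).
Implicit Types (x y s t : R) (l : seq R).

Fixpoint path_sum x l : R :=
  if l is y :: l' then `|A y - A x| + path_sum y l' else 0.

Lemma path_sumE t x l :
  \sum_(0 <= n < size l) `|(A \o nth t (x :: l)) n.+1 - (A \o nth t (x :: l)) n| =
  path_sum x l.
Proof.
elim: l x => [|y l IHl] x; first by rewrite big_nil.
by rewrite [size _]/= big_nat_recl//= -IHl.
Qed.

Lemma path_variationE t :
  path_variation A t = ereal_sup [set (path_sum 0 l)%:E | l in itv_partition 0 t].
Proof.
rewrite /path_variation; congr ereal_sup.
by apply: eq_imagel => l _ /=; rewrite path_sumE.
Qed.

Lemma path_sum_rcons x l y :
  path_sum x (rcons l y) = path_sum x l + `|A y - A (last x l)|.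
Proof. by elim: l x => [|z l IHl] x /=; rewrite ?add0r ?addr0// IHl addrA. Qed.

Lemma path_variation0 : path_variation A 0 = 0%E.
Proof.
rewrite path_variationE (_ : itv_partition 0 0 = [set [::]]) ?image_set1 ?ereal_sup1//.
apply/seteqP; split=> [[|x l]//|_ ->]; last by split.
move=> [/= /andP[x0 pl] /eqP lx]; exfalso.
have := x0; rewrite ltNge => /negP; apply; rewrite -[leRHS]lx.
by elim: l x {x0 lx} pl => //= y l IHl x /andP[xy] /IHl; apply: le_trans; exact: ltW.
Qed.

(** Appending [t] to a partition of [0, s] adds exactly the last increment. *)
Lemma path_variation_superadditive s t : 0 <= s -> s <= t ->
  (path_variation A s + (`|A t - A s|)%:E <= path_variation A t)%E.
Proof.
move=> s0; rewrite le_eqVlt => /predU1P[<-|st].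
  by rewrite subrr normr0 adde0.
rewrite -leeBrDr// [leLHS]path_variationE.
apply: ge_ereal_sup => _ [l [pl /eqP ls] <-].
rewrite leeBrDr// path_variationE; apply: ereal_sup_ubound.
exists (rcons l t); last by rewrite path_sum_rcons ls EFinD.
by split; rewrite ?last_rcons// rcons_path pl/= ls.
Qed.

Variable W : R -> R.
Hypothesis AW : forall s t, 0 <= s -> s <= t -> `|A t - A s| <= W t - W s.

Lemma path_sum_le x l : 0 <= x -> path <%R x l -> path_sum x l <= W (last x l) - W x.
Proof.
elim: l x => [|y l IHl] x x0 /=; first by rewrite subrr.
move=> /andP[xy pl]; have y0 : 0 <= y by rewrite (le_trans x0)// ltW.
by have := IHl y y0 pl; have := AW x0 (ltW xy); lra.
Qed.

(** The points up to [s] are kept, [s] replaces the first later one, and everything after [s] is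
    charged to [W]. *)
Lemma path_sum_cut x s t l : 0 <= x -> x <= s -> s <= t -> path <%R x l ->
  last x l = t ->
  exists l', [/\ path <%R x l', last x l' = s &
    path_sum x l <= path_sum x l' + (W t - W s)].
Proof.
elim: l x => [|y l IHl] x x0 xs st /=.
  move=> _ xt; exists [::]; split => //=; last first.
    by rewrite add0r subr_ge0; have := AW (le_trans x0 xs) st; have := normr_ge0 (A t - A s); lra.
  by apply/eqP; rewrite eq_le xs xt st.
move=> /andP[xy pl] lt_; have y0 : 0 <= y by rewrite (le_trans x0)// ltW.
have [ys|sy] := leP y s.
  have [l' [pl' ls' le']] := IHl y y0 ys st pl lt_.
  by exists (y :: l'); rewrite /= xy pl' ls'; split => //; rewrite -addrA lerD2l.
have s0 := le_trans x0 xs.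
have le_sum : `|A y - A x| + path_sum y l <= `|A s - A x| + (W t - W s).
  have := path_sum_le y0 pl; rewrite lt_ => yl.
  have := AW s0 (ltW sy); have := ler_distD (A s) (A y) (A x); lra.
(* Partitions are strictly increasing, so [s] may not be appended when it is already the current
   point. *)
have [xs_|xs_] := eqVneq x s.
  exists [::]; split => //=; apply: (le_trans le_sum).
  by rewrite xs_ subrr normr0.
exists [:: s]; split => //=; first by rewrite andbT lt_neqAle xs_.
by rewrite addr0.
Qed.

(** Serves twice: with [W] equal to K Q it gives dV <= K dQ, and with [W] the indefinite integral of
    |q| it bounds the variation by that integral. *)
Lemma path_variation_le s t : 0 <= s -> s <= t ->
  (path_variation A t <= path_variation A s + (W t - W s)%:E)%E.
Proof.
move=> s0 st; rewrite [leLHS]path_variationE.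
apply: ge_ereal_sup => _ [l [pl /eqP lt_] <-].
have [l' [pl' ls' le']] := path_sum_cut (lexx 0) s0 st pl lt_.
apply: (@le_trans _ _ ((path_sum 0 l')%:E + (W t - W s)%:E)).
  by rewrite -EFinD lee_fin.
rewrite leeD2r// path_variationE; apply: ereal_sup_ubound; exists l' => //.
by split => //; apply/eqP.
Qed.

End path_variation_theory.

Section stieltjes_measures.
Context {R : realType}.
Implicit Types F H : cumulative R R.

Lemma stieltjes_itv F (s t : R) : s <= t ->
  lebesgue_stieltjes_measure F `]s, t]%classic = (F t - F s)%:E.
Proof.
move=> st; rewrite /lebesgue_stieltjes_measure /measure_extension.
rewrite measurable_mu_extE /=; last exact: is_ocitv.
by rewrite wlength_itv_bnd.
Qed.

(** A comparison of outer measures, for arbitrary [A]: each cover by half-open intervals costs for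
    [F] at most [K] times what it costs for [H]. The proof divides by [K]. *)
Lemma stieltjes_le_scale F H (K : R) (A : set R) : 0 < K ->
  (forall s t, s <= t -> F t - F s <= K * (H t - H s)) ->
  (lebesgue_stieltjes_measure F A <= K%:E * lebesgue_stieltjes_measure H A)%E.
Proof.
move=> K0 FH; rewrite -lee_pdivrMl//.
apply: le_ereal_inf_tmp => _ [S [mS AS] <-].
rewrite lee_pdivrMl// -nneseriesZl//.
apply: (@le_trans _ _ (\sum_(0 <= k <oo) wlength F (S k))%E).
  by apply: ereal_inf_lbound; exists S.
apply: lee_nneseries => [i _ _|i _]; first exact: measure_ge0.
have [[s t] _ <-] := mS i => /=.
have [st|ts] := leP s t; first by rewrite !wlength_itv_bnd// -EFinM lee_fin FH.
by rewrite set_itv_ge ?bnd_simp -?leNgt ?(ltW ts)// !wlength0 mule0.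
Qed.

Lemma cumulative_of f :
  (forall s t, 0 <= s -> s <= t -> f s <= f t) ->
  (forall t : R, 0 <= t -> f @ t^'+ --> f t) ->
  exists F : cumulative R R, forall t : R, F t = f (Num.max 0 t).
Proof.
move=> f_nd f_rc; pose g (t : R) : R := f (Num.max 0 t).
have g_nd : nondecreasing g.
  move=> s t st; apply: f_nd; first by rewrite le_max lexx.
  by rewrite ge_max le_max lexx/= le_max st orbT.
have g_rc : right_continuous g.
  move=> t; rewrite /g; case: (boolP (t < 0)) => [t0|].
    rewrite (max_l (ltW t0)).
    apply: (@cvg_trans _ ((fun=> f 0) @ t^'+)); last exact: cvg_cst.
    apply: near_eq_cvg; near=> s.
    by rewrite max_l//; near: s; exact: nbhs_right_le.
  rewrite -leNgt => t0; rewrite (max_r t0).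
  apply: (@cvg_trans _ (f @ t^'+)); last exact: f_rc.
  apply: near_eq_cvg; near=> s; rewrite max_r//.
  by rewrite (le_trans t0).
pose F : cumulative R R := HB.pack g (isCumulative.Build R _ R g g_nd g_rc).
by exists F.
Unshelve. all: by end_near. Qed.

End stieltjes_measures.

Section restricted_measure.
Context d (T : measurableType d) (R : realType) (mu : {measure set T -> \bar R}).
Variable D : set T.
Hypotheses (mD : measurable D) (muD : (mu D < +oo)%E).
Implicit Type A : set T.

(** Real-valued, so that complements become differences and disjoint unions become convergent real
    series. *)
Definition restr_real A : R := fine (mu (A `&` D)).

Lemma restr_fin_num A : measurable A -> mu (A `&` D) \is a fin_num.
Proof.
move=> mA; rewrite ge0_fin_numE//; apply: le_lt_trans muD.
by apply: le_measure; rewrite ?inE//; exact: measurableI.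
Qed.

Lemma restr_real_ge0 A : 0 <= restr_real A. Proof. exact: fine_ge0. Qed.

Lemma restr_realC A : measurable A ->
  restr_real (~` A) = restr_real [set: T] - restr_real A.
Proof.
move=> mA; apply/eqP; rewrite eq_sym subr_eq; apply/eqP.
rewrite /restr_real -fineD ?restr_fin_num//; last exact: measurableC.
rewrite -measureU//=; first by rewrite -setIUl setUC setUCr.
- by apply: measurableI => //; exact: measurableC.
- exact: measurableI.
- by rewrite setIACA setICl set0I.
Qed.

Lemma restr_real_bigcup (F : nat -> set T) : (forall i, measurable (F i)) ->
  trivIset setT F ->
  series (restr_real \o F) @ \oo --> restr_real (\bigcup_i F i).
Proof.
move=> mF tF.
have mFD i : measurable (F i `&` D) by exact: measurableI.
have tFD : trivIset setT (fun i => F i `&` D) by exact: trivIset_setIr.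
have := @measure_sigma_additive _ _ _ mu _ mFD tFD.
rewrite -setI_bigcupl.
have mU : measurable (\bigcup_i F i) by exact: bigcupT_measurable.
rewrite -[X in _ --> X]fineK ?restr_fin_num// => /fine_cvgP[_].
apply: cvg_trans; apply: near_eq_cvg; near=> n.
by rewrite /= /series/= -sum_fine//= => i _; exact: restr_fin_num.
Unshelve. all: by end_near. Qed.

Lemma restr_real_sum_le (F : nat -> set T) n : (forall i, measurable (F i)) ->
  trivIset setT F ->
  \sum_(0 <= i < n) restr_real (F i) <= restr_real [set: T].
Proof.
move=> mF tF; have cF := restr_real_bigcup mF tF.
have mU : measurable (\bigcup_i F i) by exact: bigcupT_measurable.
apply: (@le_trans _ _ (restr_real (\bigcup_i F i))); last first.
  by rewrite fine_le ?restr_fin_num// le_measure ?inE//;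
    [exact: measurableI|exact: measurableI|exact: setSI].
rewrite -(cvg_lim _ cF)//.
apply: (@nondecreasing_cvgn_le _ (series (restr_real \o F))).
  by apply: nondecreasing_series => i _ _; exact: restr_real_ge0.
by apply/cvg_ex; eexists; exact: cF.
Qed.

End restricted_measure.

(** * The vector measure of a path dominated by a cumulative function *)

Section stieltjes_vector_measure.
Context {R : realType} {G : completeNormedModType R} (V : cumulative R R)
  (P : R -> G) (a b : R).
Hypotheses (ab : a <= b)
  (PV : forall s t, s <= t -> `|P t - P s| <= V t - V s).
Implicit Types (A : set (measurableTypeR R)) (F : cumulative R R).

(** Increments of [phi \o P] are at most those of [V] in absolute value: this makes the sum
    nondecreasing and passes right continuity from [V] to [phi \o P]. *)
Lemma perturbed_cumulative (phi : {linear G -> R^o}) :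
  (forall z, `|phi z| <= `|z|) ->
  exists F : cumulative R R, forall t, F t = V t + phi (P t).
Proof.
move=> phi1; pose f (t : R) : R := V t + phi (P t).
have phiP s t : s <= t -> `|phi (P t) - phi (P s)| <= V t - V s.
  by move=> st; rewrite -linearB (le_trans (phi1 _))// PV.
have f_nd : nondecreasing f.
  by move=> s t /phiP; rewrite /f ler_norml => /andP[? _]; lra.
have f_rc : right_continuous f.
  move=> t; have Vt : V @ t^'+ --> V t := cumulative_is_right_continuous V t.
  apply: cvgD => //; apply/cvgrPdist_le => e e0.
  move/cvgrPdist_le : Vt => /(_ e e0) Ve; near=> s.
  have ts : t <= s by near: s; exact: nbhs_right_ge.
  rewrite distrC (le_trans (phiP _ _ ts))// (le_trans (ler_norm _))//.
  by rewrite distrC; near: s.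
pose F : cumulative R R := HB.pack f (isCumulative.Build R _ R f f_nd f_rc).
by exists F.
Unshelve. all: by end_near. Qed.

Local Notation stieltjes_on F :=
  (restr_real (lebesgue_stieltjes_measure F) `]a, b]%classic).

Let mI : measurable (`]a, b]%classic : set (measurableTypeR R)).
Proof. by apply: sub_sigma_algebra; exact: is_ocitv. Qed.

Let finI F : (lebesgue_stieltjes_measure F `]a, b]%classic < +oo)%E.
Proof. by rewrite stieltjes_itv// ltry. Qed.

(* v is the value at A of the vector Stieltjes measure dP; it is characterized
   by scalar measures, V + phi o P being nondecreasing. *)
Definition stieltjes_value A (v : G) :=
  forall phi : {linear G -> R^o}, (forall z, `|phi z| <= `|z|) ->
  forall F, (forall t, F t = V t + phi (P t)) ->
    stieltjes_on F A = stieltjes_on V A + phi v.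

(** For phi attaining the norm at -v, the perturbed measure of [A] is the [V]-measure minus |v|, and
    it is nonnegative. *)
Lemma stieltjes_value_norm A v : stieltjes_value A v -> `|v| <= stieltjes_on V A.
Proof.
move=> Av; have [phi [phiv phi1]] := norming_functional (- v).
have [F FE] := perturbed_cumulative phi1.
have := restr_real_ge0 (lebesgue_stieltjes_measure F) `]a, b]%classic A.
by rewrite (Av phi phi1 F FE) -[v in phi v]opprK linearN phiv subr_ge0 normrN.
Qed.

Lemma stieltjes_value_unique A v w :
  stieltjes_value A v -> stieltjes_value A w -> v = w.
Proof.
move=> Av Aw; apply: eq_unit_functional => phi phi1.
have [F FE] := perturbed_cumulative phi1.
by have := Av phi phi1 F FE; rewrite (Aw phi phi1 F FE) => /addrI.
Qed.

Lemma stieltjes_value_itv s t : a <= s -> s <= t -> t <= b ->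
  stieltjes_value `]s, t]%classic (P t - P s).
Proof.
move=> sa st tb phi phi1 F FE.
have st_ab : `]s, t] `&` `]a, b] = `]s, t]%classic.
  by apply/setIidPl/subset_itv; rewrite bnd_simp.
rewrite /restr_real st_ab /= !stieltjes_itv//= !FE linearB; ring.
Qed.

Lemma stieltjes_valueT : stieltjes_value [set: measurableTypeR R] (P b - P a).
Proof.
move=> phi phi1 F FE; have := stieltjes_value_itv (lexx a) ab (lexx b) phi1 FE.
by rewrite /restr_real setIid setTI.
Qed.

Lemma stieltjes_valueC A v : measurable A -> stieltjes_value A v ->
  stieltjes_value (~` A) (P b - P a - v).
Proof.
move=> mA Av phi phi1 F FE; rewrite !(restr_realC mI) ?finI//.
rewrite (Av phi phi1 F FE) (stieltjes_valueT phi1 FE) [phi (_ - v)]linearB.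
by rewrite opprD addrACA.
Qed.

(** The norms of the [v i] are dominated by the summable [V]-measures of the [A i], so completeness
    yields [w]; each phi then passes to the limit. *)
Lemma stieltjes_value_bigcup (A : nat -> set (measurableTypeR R)) (v : nat -> G) :
  (forall i, measurable (A i)) -> trivIset setT A ->
  (forall i, stieltjes_value (A i) (v i)) ->
  exists2 w, series v @ \oo --> w & stieltjes_value (\bigcup_i A i) w.
Proof.
move=> mA tA Av.
have cvgA F := restr_real_bigcup mI (finI F) mA tA.
have : cvg (series v @ \oo).
  apply: normed_cvg.
  apply: (@series_le_cvg _ _ (fun i => stieltjes_on V (A i))) => [i|i|i|].
  - exact: normr_ge0.
  - exact: restr_real_ge0.
  - exact: stieltjes_value_norm (Av i).
  - by apply/cvg_ex; eexists; exact: cvgA.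
move=> /cvg_ex[w vw]; exists w => // phi phi1 F FE.
have cphi := unit_functional_continuous phi1.
apply: (cvg_unique _ (cvgA F)) => //.
have -> : series (stieltjes_on F \o A) =
    series (stieltjes_on V \o A) \+ (phi \o series v).
  apply/funext => n /=; rewrite /series/= linear_sum -big_split/=.
  by apply: eq_bigr => i _; exact: Av.
by apply: cvgD; [exact: cvgA|apply: continuous_cvg => //; exact: cphi].
Qed.

Lemma stieltjes_value_exists A : measurable A -> exists v, stieltjes_value A v.
Proof.
move: A; apply: (@dynkin_induction _ (measurableTypeR R) (@ocitv R)
  (fun A => exists v, stieltjes_value A v)) => //.
- exact: ocitvI.
- by exists (P b - P a); exact: stieltjes_valueT.
- move=> _ [[s t] _ <-] /=.
  (* The empty trace gets the value 0 separately, since the difference of [P] at crossed endpoints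
     need not vanish. *)
  have cut : `]s, t] `&` `]a, b] = `]Num.max s a, Num.min t b]%classic.
    apply/seteqP; split=> x /=; rewrite !in_itv/= gt_max le_min.
      by move=> [/andP[-> ->] /andP[-> ->]].
    by move=> /andP[/andP[-> ->] /andP[-> ->]].
  have [le_st|lt_ts] := leP (Num.max s a) (Num.min t b).
    exists (P (Num.min t b) - P (Num.max s a)) => phi phi1 F FE.
    have := @stieltjes_value_itv (Num.max s a) (Num.min t b) _ le_st _ phi phi1 F FE.
    rewrite /restr_real -cut -setIA setIid; apply; by rewrite ?le_max ?ge_min lexx ?orbT.
  exists 0 => phi phi1 F FE.
  rewrite /restr_real cut set_itv_ge ?bnd_simp -?leNgt ?(ltW lt_ts)//.
  by rewrite !measure0 linear0 addr0.
- move=> A mA [v Av]; exists (P b - P a - v); exact: stieltjes_valueC.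
- move=> A mA tA /choice[v Av].
  by have [w _ Aw] := stieltjes_value_bigcup mA tA Av; exists w.
Qed.

(** Values are chosen set by set; their uniqueness makes the choices agree with sums over disjoint
    unions and with the increments on intervals. *)
Lemma stieltjes_vector_measure :
  exists nu : set (measurableTypeR R) -> G,
    [/\ vector_measure nu,
        forall A, measurable A -> `|nu A| <= stieltjes_on V A &
        forall s t, a <= s -> s <= t -> t <= b -> nu `]s, t]%classic = P t - P s].
Proof.
pose nu A := xget 0 [set v | stieltjes_value A v].
have nuE A : measurable A -> stieltjes_value A (nu A).
  by move=> /stieltjes_value_exists; exact: (@xgetPex _ 0 [set v | stieltjes_value A v]).
exists nu; split=> [A mA tA|A mA|s t sa st tb].
- have [w nuw Aw] := stieltjes_value_bigcup mA tA (fun i => nuE _ (mA i)).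
  have mU : measurable (\bigcup_i A i) by exact: bigcupT_measurable.
  rewrite (stieltjes_value_unique (nuE _ mU) Aw).
  exact: nuw.
- exact/stieltjes_value_norm/nuE.
- apply: stieltjes_value_unique (stieltjes_value_itv sa st tb).
  by apply: nuE; apply: sub_sigma_algebra; exact: is_ocitv.
Qed.

End stieltjes_vector_measure.

(** * Bochner integrals *)

Section bochner_theory.
Context d (T : measurableType d) (R : realType).
Implicit Types (mu : {measure set T -> \bar R}) (D A : set T).

(** Every preimage is a finite union of fibres. As [W] is a bare type, this also covers pairs of
    simple functions. *)
Lemma finite_range_comp_measurable (W : Type) (u : T -> W) (h : W -> R) :
  finite_set (range u) -> (forall w, measurable (u @^-1` [set w])) ->
  measurable_fun setT (h \o u).
Proof.
move=> finu mu _ Y mY; rewrite setTI.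
rewrite (_ : _ @^-1` Y = \bigcup_(w in range u `&` h @^-1` Y) (u @^-1` [set w])).
  by apply: fin_bigcup_measurable => //; exact: finite_setIl.
apply/seteqP; split=> x /=; first by move=> Yx; exists (u x) => //=; split => //; exists x.
by move=> [w [_ Yw] /= ->].
Qed.

Context {G : normedModType R}.
Implicit Types (f : T -> G) (s : nat -> T -> G) (phi : {linear G -> R^o}).

Lemma simple_fun_comp_measurable (u : T -> G) (h : G -> R) : simple_fun u ->
  measurable_fun setT (h \o u).
Proof. by move=> [finu mu]; exact: finite_range_comp_measurable. Qed.

Lemma simple_fun_comp2_measurable (u v : T -> G) (h : G * G -> R) :
  simple_fun u -> simple_fun v -> measurable_fun setT (fun x => h (u x, v x)).
Proof.
move=> [finu mu] [finv mv].
apply: (@finite_range_comp_measurable _ (fun x => (u x, v x)) h).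
  apply: (@sub_finite_set _ _ (range u `*` range v)).
    by move=> _ [x _ <-]; split; exists x.
  exact: finite_setX.
move=> [y z]; rewrite (_ : _ @^-1` _ = u @^-1` [set y] `&` v @^-1` [set z]).
  exact: measurableI.
by apply/seteqP; split=> x /= [-> ->].
Qed.

Lemma simple_fun_comp (u : T -> G) (h : G -> G) : simple_fun u ->
  simple_fun (h \o u).
Proof.
move=> [finu mu]; split.
  rewrite (_ : range _ = h @` range u); last by rewrite image_comp.
  exact: finite_image.
move=> y; rewrite (_ : _ @^-1` _ = \bigcup_(w in range u `&` h @^-1` [set y]) (u @^-1` [set w])).
  by apply: fin_bigcup_measurable => //; exact: finite_setIl.
apply/seteqP; split=> x /=; first by move=> <-; exists (u x) => //=; split => //; exists x.
by move=> [w [_ /= Yw] /= ->].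
Qed.

Lemma strongly_measurable_comp D f (h : G -> R) : strongly_measurable D f ->
  continuous h -> measurable_fun D (h \o f).
Proof.
move=> [s [ss sf]] ch; apply: (@measurable_fun_cvg _ _ _ _ (fun n => h \o s n)).
  by move=> n; apply: measurable_funTS; exact: simple_fun_comp_measurable.
by move=> x Dx; apply: continuous_cvg; [exact: ch|exact: sf].
Qed.

Lemma strongly_measurable_dist D f (u : T -> G) : strongly_measurable D f ->
  simple_fun u -> measurable_fun D (fun x => `|f x - u x|).
Proof.
move=> [s [ss sf]] su.
apply: (@measurable_fun_cvg _ _ _ _ (fun n x => `|s n x - u x|)).
  move=> n; apply: measurable_funTS.
  exact: (simple_fun_comp2_measurable (fun z => `|z.1 - z.2|)).
by move=> x Dx; apply: cvg_norm; apply: cvgB; [exact: sf|exact: cvg_cst].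
Qed.

Lemma strongly_measurableS D A f : A `<=` D -> strongly_measurable D f ->
  strongly_measurable A f.
Proof. by move=> AD [s [ss sf]]; exists s; split=> // x /AD; exact: sf. Qed.

Section integrals.
Variables (mu : {measure set T -> \bar R}) (D : set T).
Hypothesis mD : measurable D.

(** The fibre over 0 may have infinite measure; h 0 = 0 removes its contribution. It is applied with
    [h] the norm and with [h] a functional. *)
Lemma integrable_simple_comp (u : T -> G) (h : G -> R) : h 0 = 0 ->
  integrable_simple mu D u ->
  mu.-integrable D (EFin \o (h \o u)) /\
  \int[mu]_(x in D) h (u x) =
    \sum_(y <- fset_set (range u)) fine (mu (D `&` u @^-1` [set y])) * h y.
Proof.
move=> h0 [[finu mu_] fmu].
pose F y x : \bar R := ((h y)%:E * (\1_(u @^-1` [set y]) x)%:E)%E.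
have uE x : (h (u x))%:E = (\sum_(y <- fset_set (range u)) F y x)%E.
  rewrite -(fsbig_finite _ (F ^~ x))//= (fsbigD1 (u x))//=; last by exists x.
  rewrite fsbig1 ?adde0; first by rewrite /F indicE mem_set//= mule1.
  by move=> y [_ /= yx]; rewrite /F indicE memNset ?mule0//= => xy; exact: yx.
have int1 y : y != 0 -> mu.-integrable D (fun x => (\1_(u @^-1` [set y]) x)%:E).
  move=> y0; apply/integrableP; split.
    by apply/measurable_EFinP/measurable_indic.
  under eq_integral do rewrite gee0_abs//.
  by rewrite integral_indic// setIC; exact: fmu.
have intF y : mu.-integrable D (F y).
  have [->|y0] := eqVneq y 0; last by apply: integrableZl => //; exact: int1.
  rewrite (_ : F 0 = cst 0%E); first exact: integrable0.
  by apply/funext => x; rewrite /F h0 mul0e.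
have intE y : (\int[mu]_(x in D) F y x =
    ((fine (mu (D `&` u @^-1` [set y])) * h y)%R)%:E)%E.
  have [->|y0] := eqVneq y 0.
    by rewrite h0 mulr0; apply: integral0_eq => x _; rewrite /F h0 mul0e.
  rewrite integralZl//; last exact: int1.
  rewrite integral_indic// setIC muleC EFinM fineK// ge0_fin_numE//; exact: fmu.
split.
  rewrite (_ : EFin \o _ = fun x => (\sum_(y <- fset_set (range u)) F y x)%E).
    by apply: integrable_sum => // y _; exact: intF.
  by apply/funext => x /=; rewrite uE.
rewrite /Rintegral; under eq_integral do rewrite uE.
rewrite integral_sum// (eq_bigr _ (fun y _ => intE y)).
by rewrite sumEFin.
Qed.

Lemma simple_integral_functional (u : T -> G) phi : integrable_simple mu D u ->
  phi (simple_integral mu D u) = (\int[mu]_(x in D) (phi (u x) : R))%R.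
Proof.
move=> su; rewrite (integrable_simple_comp _ su).2 ?linear0//.
rewrite /simple_integral fsbig_finite ?linear_sum//=; last by have [[]] := su.
by apply: eq_bigr => y _; rewrite linearZ.
Qed.

Variable f : T -> G.
Hypothesis mf : strongly_measurable D f.

Lemma measurable_norm : measurable_fun D (fun x => `|f x|).
Proof. by apply: (strongly_measurable_comp mf); exact: norm_continuous. Qed.

Lemma measurable_functional phi : (forall z, `|phi z| <= `|z|) ->
  measurable_fun D (fun x => phi (f x) : R).
Proof.
move=> phi1; apply: (strongly_measurable_comp mf).
exact: unit_functional_continuous.
Qed.

Lemma integrable_dist (u : T -> G) : simple_fun u ->
  (\int[mu]_(x in D) (`|f x - u x|%R)%:E < +oo)%E ->
  mu.-integrable D (fun x => (`|f x - u x|)%:E).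
Proof.
move=> su foo; apply/integrableP; split.
  exact/measurable_EFinP/strongly_measurable_dist.
by under eq_integral do rewrite gee0_abs//.
Qed.

Lemma bochner_approx_near s (e : R) : bochner_approx mu D f s -> 0 < e ->
  \forall n \near \oo, (\int[mu]_(x in D) (`|f x - s n x|%R)%:E < e%:E)%E.
Proof.
move=> [_ /fine_cvgP[sfin /cvgrPdist_lt s0]] e0; have := s0 e e0.
apply: filterS2 sfin => n /fineK nfin; rewrite sub0r normrN => ne.
by rewrite -nfin lte_fin (le_lt_trans (ler_norm _)).
Qed.

(** One approximant at finite distance is enough: |f| <= |s n| + |f - s n|. *)
Lemma bochner_norm_integrable s : bochner_approx mu D f s ->
  mu.-integrable D (fun x => (`|f x|)%:E).
Proof.
move=> sf; have /filter_ex[n sn] := bochner_approx_near sf ltr01.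
have [ssn _] := sf.1 n.
have [ints _] := integrable_simple_comp (normr0 _) (sf.1 n).
have intd := integrable_dist ssn (lt_trans sn (ltry 1)).
apply: (@le_integrable _ _ _ mu D mD _
    (fun x => (`|s n x|)%:E + (`|f x - s n x|)%:E)%E); last exact: integrableD.
  exact/measurable_EFinP/measurable_norm.
move=> x Dx /=; rewrite lee_fin normr_id ger0_norm ?addr_ge0//.
by rewrite (le_trans _ (ler_normD _ _))// addrC subrK.
Qed.

Hypothesis intf : mu.-integrable D (fun x => (`|f x|)%:E).

Lemma functional_integrable phi : (forall z, `|phi z| <= `|z|) ->
  mu.-integrable D (EFin \o (fun x => phi (f x) : R)).
Proof.
move=> phi1; apply: (@le_integrable _ _ _ mu D mD _ (fun x => (`|f x|)%:E)) => //.
  exact/measurable_EFinP/measurable_functional.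
by move=> x _ /=; rewrite lee_fin normr_id.
Qed.

(** The error is uniform over phi of norm at most 1, hence an error in norm: both the Cauchy
    property of the integrals and the identification of their limit come from it. *)
Lemma simple_integral_error (u : T -> G) phi (e : R) :
  (forall z, `|phi z| <= `|z|) -> integrable_simple mu D u ->
  (\int[mu]_(x in D) (`|f x - u x|%R)%:E < e%:E)%E ->
  `|phi (simple_integral mu D u) - (\int[mu]_(x in D) (phi (f x) : R))%R| <= e.
Proof.
move=> phi1 su ue; rewrite simple_integral_functional//.
have intd := integrable_dist su.1 (lt_trans ue (ltry e)).
have intu := (integrable_simple_comp (linear0 phi) su).1.
rewrite -RintegralB//; last exact: functional_integrable.
have intB : mu.-integrable D (EFin \o (fun x => (phi (u x) : R) - phi (f x))).
  by have := integrableB mD intu (functional_integrable phi1).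
rewrite (le_trans (le_normr_Rintegral mD intB))//.
apply: (@le_trans _ _ (\int[mu]_(x in D) `|f x - u x|)).
  apply: le_Rintegral => //; first exact: integrable_norm.
  by move=> x _; rewrite -linearB (le_trans (phi1 _))// distrC.
rewrite /Rintegral -lee_fin fineK ?(ltW ue)//.
by rewrite ge0_fin_numE ?integral_ge0// (lt_trans ue)// ltry.
Qed.

End integrals.

End bochner_theory.

Section bochner_integral_theory.
Context d (T : measurableType d) (R : realType) (G : completeNormedModType R)
  (mu : {measure set T -> \bar R}) (D : set T).
Hypothesis mD : measurable D.
Implicit Types (f : T -> G) (s : nat -> T -> G) (phi : {linear G -> R^o}).

Lemma simple_integral_cvg_functional f s v phi : strongly_measurable D f ->
  bochner_approx mu D f s -> (forall z, `|phi z| <= `|z|) ->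
  (fun n => simple_integral mu D (s n)) @ \oo --> v ->
  phi v = (\int[mu]_(x in D) (phi (f x) : R))%R.
Proof.
move=> mf sf phi1 sv.
have intf := bochner_norm_integrable mD mf sf.
have cphi := unit_functional_continuous phi1.
apply: (@cvg_unique R^o _ ((fun n => phi (simple_integral mu D (s n))) @ \oo)) => //.
  by apply: continuous_cvg; [exact: cphi|exact: sv].
apply/cvgrPdist_le => e e0; near=> n; rewrite distrC.
apply: (simple_integral_error mD mf intf phi1 (sf.1 n)).
by near: n; exact: bochner_approx_near sf e0.
Unshelve. all: by end_near. Qed.

Lemma simple_integral_cvg f s : strongly_measurable D f ->
  bochner_approx mu D f s -> cvg ((fun n => simple_integral mu D (s n)) @ \oo).
Proof.
move=> mf sf; have intf := bochner_norm_integrable mD mf sf.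
apply/cauchy_cvgP/cauchy_ballP => e e0.
have e2 : 0 < e / 3 by rewrite divr_gt0.
have [N _ Ns] := bochner_approx_near sf e2.
pose I n := simple_integral mu D (s n).
exists (I @` [set n | (N <= n)%N], I @` [set n | (N <= n)%N]) => /=.
  by split; exists N => // n Nn; exists n.
move=> [_ _] /= [[n Nn <-] [m Nm <-]]; rewrite -ball_normE /=.
apply: (@le_lt_trans _ _ (e / 3 + e / 3)); last lra.
apply: norm_le_unit_functional => phi phi1; rewrite linearB.
have := simple_integral_error mD mf intf phi1 (sf.1 n) (Ns n Nn).
have := simple_integral_error mD mf intf phi1 (sf.1 m) (Ns m Nm).
by rewrite !ler_norml => /andP[? ?] /andP[? ?]; lra.
Qed.

(** Completeness provides a limit for [xget] to select, and every admissible selection has the same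
    image under phi. *)
Lemma bochner_integral_functional f phi : bochner_integrable mu D f ->
  (forall z, `|phi z| <= `|z|) ->
  phi (bochner_integral mu D f) = (\int[mu]_(x in D) (phi (f x) : R))%R.
Proof.
move=> [mf [s sf]] phi1; rewrite /bochner_integral; set S := [set v | _].
have /(xgetPex 0)[s' s'f s'v] : exists v, S v.
  have /cvg_ex[v sv] := simple_integral_cvg mf sf.
  by exists v; exists s.
exact: simple_integral_cvg_functional mf s'f phi1 s'v.
Qed.

Lemma bochner_integral_unique f v : bochner_integrable mu D f ->
  (forall phi, (forall z, `|phi z| <= `|z|) ->
    phi v = (\int[mu]_(x in D) (phi (f x) : R))%R) ->
  v = bochner_integral mu D f.
Proof.
move=> intf vE; apply: eq_unit_functional => phi phi1.
by rewrite vE// bochner_integral_functional.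
Qed.

Lemma bochner_integrable_norm f : bochner_integrable mu D f ->
  mu.-integrable D (fun x => (`|f x|)%:E).
Proof. by move=> [mf [s]]; exact: bochner_norm_integrable. Qed.

Lemma bounded_bochner_integrable f (K : R) : strongly_measurable D f ->
  (mu D < +oo)%E -> (forall x, D x -> `|f x| <= K) -> bochner_integrable mu D f.
Proof.
move=> mf muD fK; split=> //; have [s [ss sf]] := mf.
(* The truncation gives a common bound for dominated convergence; at each point it is eventually
   inactive, once the approximants are within 1 of [f x]. *)
pose h (y : G) := if `|y| <= K + 1 then y else 0.
have sh n : simple_fun (h \o s n) by exact: simple_fun_comp.
exists (fun n => h \o s n); split.
  move=> n; split=> // y _; apply: le_lt_trans muD.
  by apply: le_measure; rewrite ?inE//; apply: measurableI => //; exact: (sh n).2.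
have cvg0 x : D x -> (fun n => (`|f x - h (s n x)|)%:E) @ \oo --> 0%:E.
  move=> Dx; apply: cvg_EFin; first by near=> n.
  apply: (@cvg_trans _ ((fun n => `|f x - s n x|) @ \oo)).
    apply: near_eq_cvg; near=> n; rewrite /= /h ifT//.
    have : `|f x - s n x| <= 1.
      by near: n; have /cvgrPdist_le := sf x Dx; apply.
    have := fK x Dx; have := ler_distD (f x) (s n x) 0.
    by rewrite !subr0 (distrC (s n x)); lra.
  have := cvg_norm (cvgB (cvg_cst (f x)) (sf x Dx)).
  by rewrite subrr normr0; exact.
rewrite -[X in _ --> X](integral0 mu D).
apply: (@dominated_cvg _ _ _ mu D mD _ _ (fun=> (K + (K + 1))%:E)) => //.
- by move=> n; apply/measurable_EFinP; exact: strongly_measurable_dist.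
- apply/integrableP; split=> //; rewrite integral_cst//.
  by rewrite lte_mul_pinfty// abse_ge0.
- move=> n x Dx /=; rewrite lee_fin normr_id.
  have K0 : 0 <= K by rewrite (le_trans _ (fK x Dx)).
  rewrite (le_trans (ler_normB _ _))// lerD ?fK// /h.
  by case: ifPn => // _; rewrite normr0 addr_ge0.
Unshelve. all: by end_near. Qed.

Lemma bochner_integrableS f (A : set T) : measurable A -> A `<=` D ->
  bochner_integrable mu D f -> bochner_integrable mu A f.
Proof.
move=> mA AD [mf [s [ss sf]]]; split; first exact: strongly_measurableS mf.
exists s; split=> [n|].
  split=> [|y y0]; first exact: (ss n).1.
  apply: le_lt_trans ((ss n).2 y y0); apply: le_measure; rewrite ?inE.
  - by apply: measurableI => //; exact: (ss n).1.2.
  - by apply: measurableI => //; exact: (ss n).1.2.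
  - exact: setSI.
apply: (squeeze_cvge _ (cvg_cst 0%E) sf); near=> n.
rewrite integral_ge0//= ge0_subset_integral//.
by apply/measurable_EFinP/strongly_measurable_dist => //; exact: (ss n).1.
Unshelve. all: by end_near. Qed.

End bochner_integral_theory.

(** * Densities *)

Section norm_integral.
Context d (T : measurableType d) (R : realType) (G : completeNormedModType R)
  (mu m : {measure set T -> \bar R}) (g : T -> G).
Hypothesis intg : bochner_integrable mu setT g.
Hypothesis dom : forall (A : set T) (phi : {linear G -> R^o}), measurable A ->
  (forall z, `|phi z| <= `|z|) ->
  ((\int[mu]_(x in A) (phi (g x) : R))%:E <= m A)%E.

(* On a set where g is close to a constant y, |g| is up to a small error the
   composition of g with one norming functional of y. *)
Lemma norm_integral_le_near_cst (A : set T) (y : G) (u : T -> G) :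
  measurable A -> (forall x, A x -> u x = y) -> simple_fun u ->
  mu.-integrable setT (fun x => (`|g x - u x|)%:E) ->
  (\int[mu]_(x in A) (`|g x|)%:E <=
    m A + \int[mu]_(x in A) (2 * `|g x - u x|)%:E)%E.
Proof.
move=> mA uy su intd; have [phi [phiy phi1]] := norming_functional y.
have intgA : bochner_integrable mu A g by exact: bochner_integrableS intg.
have intphi := functional_integrable mA intgA.1
  (bochner_integrable_norm mA intgA) phi1.
have intdA : mu.-integrable A (fun x => (2 * `|g x - u x|)%:E).
  rewrite (_ : (fun x => _) = fun x => (2%:E * (`|g x - u x|)%:E)%E).
    by apply: integrableZl => //; exact: integrableS intd.
  by apply/funext => x; rewrite EFinM.
apply: (@le_trans _ _ (\int[mu]_(x in A)
    ((phi (g x) : R)%:E + (2 * `|g x - u x|)%:E))%E).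
  apply: ge0_le_integral => //.
  - exact/measurable_EFinP/(measurable_norm intgA.1).
  - by apply: measurable_int (integrableD mA intphi intdA).
  (* Since phi y = |y|, one has |g| <= phi y + |g - y| <= phi g + 2 |g - y|, the origin of the
     factor 2. *)
  - move=> x Ax; rewrite lee_fin uy//.
    have := ler_distD y (g x) 0; rewrite !subr0 -phiy.
    have := phi1 (y - g x); rewrite linearB distrC ler_norml => /andP[_].
    lra.
rewrite integralD// leeD2r// (le_trans _ (dom mA phi1))// /Rintegral fineK//.
exact: integrable_fin_num intphi.
Qed.

(** The hypothesis [dom] treats one functional at a time, while the norming functional changes with
    the value of [g]. So [A] is cut along the finitely many fibres of a simple [u] close to [g], and
    additivity of [m] reassembles the pieces. *)
Lemma norm_integral_le (A : set T) : measurable A ->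
  (\int[mu]_(x in A) (`|g x|)%:E <= m A)%E.
Proof.
move=> mA; have [mg [s sg]] := intg.
apply/lee_addgt0Pr => e e0; have e2 : 0 < e / 2 by rewrite divr_gt0.
have /filter_ex[n sn] := bochner_approx_near sg e2.
set u := s n in sn; have su : simple_fun u := (sg.1 n).1.
have intd : mu.-integrable setT (fun x => (`|g x - u x|)%:E).
  by apply: integrable_dist => //; exact: lt_trans sn (ltry _).
pose F y := A `&` u @^-1` [set y].
have mF y : measurable (F y) by apply: measurableI => //; exact: su.2.
have tF S : trivIset S F by move=> y z _ _ [x [[_ <-] [_ <-]]].
have AE : A = \bigcup_(y in range u) F y.
  apply/seteqP; split=> [x Ax|x [y _ []]//].
  by exists (u x); [exists x|split].
have AE' : A = \big[setU/set0]_(y <- fset_set (range u)) F y.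
  by rewrite bigsetU_fset_set//; exact: su.1.
have split_int (h : T -> \bar R) : measurable_fun setT h -> (forall x, (0 <= h x)%E) ->
    (\int[mu]_(x in A) h x =
     \sum_(y <- fset_set (range u)) \int[mu]_(x in F y) h x)%E.
  move=> mh h0; rewrite [in LHS]AE' ge0_integral_bigsetU//.
  by rewrite -AE'; exact: measurable_funTS.
rewrite split_int//; last exact/measurable_EFinP/(measurable_norm mg).
have mh : measurable_fun setT (fun x => (2 * `|g x - u x|)%:E).
  apply/measurable_EFinP; apply: measurable_funM => //.
  exact: strongly_measurable_dist.
apply: (@le_trans _ _ (m A + \int[mu]_(x in A) (2 * `|g x - u x|)%:E)%E).
  rewrite split_int// [in leRHS]AE measure_fin_bigcup//; last exact: su.1.
  rewrite (fsbig_finite _ _ su.1)/=.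
  rewrite -big_split/=; apply: lee_sum => y _.
  by apply: norm_integral_le_near_cst => // x [_ ->].
rewrite leeD2l//; apply: (@le_trans _ _ (\int[mu]_x (2 * `|g x - u x|)%:E)%E).
  by apply: ge0_subset_integral.
under eq_integral do rewrite EFinM.
rewrite integralZl//; apply: (@le_trans _ _ (2%:E * (e / 2)%:E)%E).
  by rewrite lee_pmul2l// ltW.
by rewrite -EFinM lee_fin; lra.
Qed.

End norm_integral.

Section norm_bound.
Context d (T : measurableType d) (R : realType) (mu : {measure set T -> \bar R}).

(** Where f > K the positive function f - K has integral at most 0; finiteness of [mu] allows the
    subtraction. *)
Lemma null_superlevel (f : T -> R) (K : R) : (mu setT < +oo)%E ->
  measurable_fun setT f -> (forall x, 0 <= f x) ->
  (forall A, measurable A -> (\int[mu]_(x in A) (f x)%:E <= K%:E * mu A)%E) ->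
  mu [set x | K < f x] = 0%E.
Proof.
move=> muT mf f0 fK; set N := [set x | K < f x].
have mN : measurable N.
  rewrite (_ : N = setT `&` f @^-1` `]K, +oo[%classic) ?set_itvoy ?setTI//.
  rewrite -[X in measurable X]setTI; apply: mf => //.
  by rewrite -set_itvoy; exact: measurable_itv.
have muN : mu N \is a fin_num.
  by rewrite ge0_fin_numE// (le_lt_trans _ muT)// le_measure// ?inE.
have intK : mu.-integrable N (cst K%:E).
  apply/integrableP; split=> //; rewrite integral_cst// lte_mul_pinfty//.
  by rewrite -ge0_fin_numE.
have intf : mu.-integrable N (EFin \o f).
  apply/integrableP; split; first by apply/measurable_EFinP; exact: measurable_funTS.
  under eq_integral do rewrite gee0_abs ?lee_fin ?f0//.
  by rewrite (le_lt_trans (fK N mN))// ltey_eq fin_numM.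
have /ae_eq_integral_abs : (\int[mu]_(x in N) `|(f x - K)%:E| = 0)%E.
  apply/eqP; rewrite eq_le integral_ge0// andbT.
  under eq_integral => x.
    rewrite inE /N /= => Kf; rewrite ger0_norm ?subr_ge0 ?(ltW Kf)//.
    rewrite EFinB; over.
  rewrite integralB_EFin// integral_cst// leeBlDr ?fin_numM//.
  by rewrite add0e; exact: fK.
move=> /(_ mN); case.
  by apply/measurable_EFinP/measurable_funTS/measurable_funB.
move=> M [mM muM NM].
apply/eqP; rewrite eq_le measure_ge0 andbT -muM.
apply: le_measure; rewrite ?inE// => x Nx; apply: NM => /= /(_ Nx) /eqP.
by rewrite eqe subr_eq0 gt_eqF.
Qed.

End norm_bound.

Section stieltjes_density.
Context {R : realType} {G : completeNormedModType R}.
Hypothesis RN : radon_nikodym_property G.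
Variables (mu : {measure set (measurableTypeR R) -> \bar R})
  (V : cumulative R R) (P : R -> G) (K a b : R).
Hypotheses (ab : a <= b) (K0 : 0 <= K)
  (PV : forall s t, s <= t -> `|P t - P s| <= V t - V s)
  (muI : (mu `]a, b]%classic < +oo)%E)
  (VK : forall A : set (measurableTypeR R), measurable A -> A `<=` `]a, b]%classic ->
    (lebesgue_stieltjes_measure V A <= K%:E * mu A)%E).

Let mI : measurable (`]a, b]%classic : set (measurableTypeR R)).
Proof. by apply: sub_sigma_algebra; exact: is_ocitv. Qed.

Let VI : (lebesgue_stieltjes_measure V `]a, b]%classic < +oo)%E.
Proof. by rewrite stieltjes_itv// ltry. Qed.

Let mV : {measure set (measurableTypeR R) -> \bar R} :=
  mfrestr (f := lebesgue_stieltjes_measure V) mI VI.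

Let muab : {finite_measure set (measurableTypeR R) -> \bar R} :=
  mfrestr (f := mu) mI muI.

(** Absolute continuity is |nu A| <= dV(A) <= K mu(A) on the block; bounded variation comes from the
    finite mass of dV there. *)
Lemma stieltjes_radon_nikodym :
  exists2 g : R -> G, bochner_integrable muab setT (g : measurableTypeR R -> G) &
    exists nu : set (measurableTypeR R) -> G,
    [/\ forall A, measurable A -> (`|nu A|%:E <= mV A)%E,
        forall A, measurable A -> nu A = bochner_integral muab A g &
        forall s t, a <= s -> s <= t -> t <= b -> nu `]s, t]%classic = P t - P s].
Proof.
have [nu [nu_add nu_le nu_itv]] := stieltjes_vector_measure ab PV.
have nu_bv : vm_bounded_variation nu.
  exists (restr_real (lebesgue_stieltjes_measure V) `]a, b]%classic setT).
  move=> n F mF tF; apply: le_trans (restr_real_sum_le mI VI n mF tF).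
  by apply: ler_sum => i _; exact: nu_le.
have nu_ac : vm_abs_continuous nu muab.
  move=> A mA A0; apply/eqP; rewrite -normr_le0 (le_trans (nu_le A mA))//.
  rewrite -lee_fin /restr_real fineK; last exact: restr_fin_num.
  rewrite (le_trans (VK (measurableI _ _ mA mI) (@subIsetr _ _ _)))//.
  by rewrite [mu _]A0 mule0.
have [g intg nuE] := RN nu_add nu_bv nu_ac.
exists g => //; exists nu; split => // A mA.
rewrite -[leRHS]fineK ?lee_fin; first exact: nu_le.
exact: (@restr_fin_num _ _ _ (lebesgue_stieltjes_measure V) _ mI VI _ mA).
Qed.

Lemma stieltjes_density :
  exists g : R -> G,
    [/\ strongly_measurable setT (g : measurableTypeR R -> G),
        forall x, `|g x| <= K,
        forall (phi : {linear G -> R^o}) s t, (forall z, `|phi z| <= `|z|) ->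
          a <= s -> s <= t -> t <= b ->
          phi (P t - P s) = \int[mu]_(x in `]s, t]) (phi (g x) : R) &
        forall s t, a <= s -> s <= t -> t <= b ->
          (\int[mu]_(x in `]s, t]) (`|g x|)%:E <= (V t - V s)%:E)%E].
Proof.
have [g0 intg [nu [nu_le nuE nu_itv]]] := stieltjes_radon_nikodym.
have nu_phi A (phi : {linear G -> R^o}) : measurable A ->
    (forall z, `|phi z| <= `|z|) ->
    phi (nu A) = \int[muab]_(x in A) (phi (g0 x) : R).
  move=> mA phi1; rewrite nuE// bochner_integral_functional//.
  exact: bochner_integrableS intg.
have g0V A : measurable A -> (\int[muab]_(x in A) (`|g0 x|)%:E <= mV A)%E.
  apply: norm_integral_le => // {}A phi mA phi1.
  rewrite -nu_phi// (le_trans _ (nu_le A mA))// lee_fin.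
  by rewrite (le_trans (ler_norm _)).
have mg0 := intg.1; have mnorm := measurable_norm mg0.
pose N := [set x : measurableTypeR R | K < `|g0 x|].
have N0 : muab N = 0%E.
  apply: (@null_superlevel _ _ _ muab (fun x => `|g0 x|) K) => //.
  - by rewrite -ge0_fin_numE//; exact: fin_num_measure.
  - move=> A mA; rewrite (le_trans (g0V A mA))//; apply: VK.
      exact: measurableI.
    exact: subIsetr.
have mN : measurable N.
  rewrite (_ : N = setT `&` (fun x => `|g0 x|) @^-1` `]K, +oo[%classic).
    by apply: mnorm => //; exact: measurable_itv.
  by rewrite setTI set_itvoy.
(* Putting 0 on the null set [N] makes the bound hold everywhere, so that the later gluing and
   integrability arguments meet no exceptional sets. *)
pose g x := if K < `|g0 x| then 0 else g0 x.
have gg0 : {ae muab, forall x, g x = g0 x}.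
  exists N; split=> // x /= gx; rewrite /N /=; apply: contrapT => Kx; apply: gx.
  by rewrite /g (negbTE (introN idP Kx)).
have mg : strongly_measurable setT (g : measurableTypeR R -> G).
  have [s [ss sg]] := mg0.
  exists (fun n x => if K < `|g0 x| then 0 else s n x); split=> [n|x _].
    split.
      apply: (@sub_finite_set _ _ (range (s n) `|` [set 0])).
        by move=> _ [x _ <-]; case: ifPn => _; [right|left; exists x].
      by rewrite finite_setU; split; [exact: (ss n).1|exact: finite_set1].
    move=> y; rewrite (_ : _ @^-1` _ =
        (~` N `&` s n @^-1` [set y]) `|` (N `&` [set x | y = 0])).
      apply: measurableU.
        by apply: measurableI; [exact: measurableC|exact: (ss n).2].
      have [->|/eqP y0] := eqVneq y 0.
        by rewrite (_ : [set _ | _] = setT) ?setIT//; apply/seteqP; split.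
      by rewrite (_ : [set _ | _] = set0) ?setI0//; apply/seteqP; split.
    apply/seteqP; split=> x /=; rewrite /N /=.
      by case: ifPn => Kx <-; [right|left].
    by case: ifPn => Kx [[]|[]].
  by rewrite /g; case: ifPn => // _; [exact: cvg_cst|exact: sg].
have mu_itv s t : a <= s -> s <= t -> t <= b ->
    measurable (`]s, t]%classic : set (measurableTypeR R)) /\
    forall f : measurableTypeR R -> \bar R,
      (\int[muab]_(x in `]s, t]) f x = \int[mu]_(x in `]s, t]) f x)%E.
  move=> as_ st tb; split; first by apply: sub_sigma_algebra; exact: is_ocitv.
  move=> f; apply: eq_measure_integral => A mA Ast; rewrite /muab/= /mfrestr /mrestr; congr (mu _).
  apply/setIidPl; apply: (subset_trans Ast).
  by apply: subset_itv; rewrite bnd_simp.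
exists g; split => //.
- by move=> x; rewrite /g; case: ifPn; rewrite ?normr0// -leNgt.
- move=> phi s t phi1 as_ st tb; have [mst muE] := mu_itv _ _ as_ st tb.
  rewrite -nu_itv// nu_phi//; congr fine.
  transitivity (\int[muab]_(x in `]s, t]) (phi (g x) : R)%:E)%E.
    apply: ae_eq_integral => //.
    - apply/measurable_EFinP; apply: measurable_functional => //.
      exact: strongly_measurableS mg0.
    - apply/measurable_EFinP; apply: measurable_functional => //.
      exact: strongly_measurableS mg.
    - have [M [mM M0 gM]] := gg0; exists M; split=> // x /= gx.
      by apply: gM => /= gg0x; apply: gx => _; rewrite gg0x.
  exact: muE.
- move=> s t as_ st tb; have [mst muE] := mu_itv _ _ as_ st tb.
  rewrite -muE.
  apply: (@le_trans _ _ (\int[muab]_(x in `]s, t]) (`|g0 x|)%:E)%E).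
    apply: ge0_le_integral => //.
    - apply/measurable_EFinP; apply: measurable_norm.
      exact: strongly_measurableS mg.
    - by apply/measurable_EFinP; exact: measurable_funTS.
    - by move=> x _; rewrite lee_fin /g; case: ifPn => _; rewrite ?normr0.
  rewrite (le_trans (g0V _ mst))// -(stieltjes_itv V st).
  by apply: le_measure; rewrite ?inE//; exact: measurableI.
Qed.

End stieltjes_density.

(** * From unit blocks to the half-line *)

Section unit_blocks.
Context {R : realType}.

Lemma exists_block (x : R) : 0 < x -> exists k : nat, k%:R < x <= k.+1%:R.
Proof.
move=> x0; have ex : exists n, x <= n.+1%:R.
  by exists (Num.bound x); rewrite (le_trans (ltW (archi_boundP (ltW x0))))// ler_nat.
exists (ex_minn ex); case: ex_minnP => [[|k]] -> min; first by rewrite x0.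
by rewrite andbT ltNge; apply/negP => /min; rewrite ltnn.
Qed.

Lemma block_unique (x : R) (j k : nat) :
  j%:R < x <= j.+1%:R -> k%:R < x <= k.+1%:R -> j = k.
Proof.
move=> /andP[jx xj] /andP[kx xk]; apply/eqP; rewrite eqn_leq.
by rewrite -ltnS -(ltr_nat R) (lt_le_trans jx xk) -ltnS -(ltr_nat R) (lt_le_trans kx xj).
Qed.

(** Induction on an integer bound for [t], cutting at [n] the intervals that straddle it. *)
Lemma block_induction (S : R -> R -> Prop) :
  (forall s u t, 0 <= s -> s <= u -> u <= t -> S s u -> S u t -> S s t) ->
  (forall (k : nat) s t, k%:R <= s -> s <= t -> t <= k.+1%:R -> S s t) ->
  forall s t, 0 <= s -> s <= t -> S s t.
Proof.
move=> Scat Sblock s t s0 st.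
suff gen (n : nat) : forall s t, 0 <= s -> s <= t -> t <= n%:R -> S s t.
  apply: (gen (Num.bound t)) => //.
  exact/ltW/archi_boundP/(le_trans s0 st).
elim: n => [|n IHn] {s0 st}s {}t s0 st tn.
  by apply: (Sblock 0) => //; rewrite (le_trans tn)// ler_nat.
have [tn'|nt] := leP t n%:R; first exact: IHn.
have [ns|sn] := leP n%:R s; first exact: Sblock tn.
apply: (Scat _ n%:R) => //; [exact: ltW|exact: ltW| |].
  by apply: IHn => //; exact: ltW.
by apply: (Sblock n) => //; exact: ltW.
Qed.

End unit_blocks.

Section glue.
Context {R : realType} {G : normedModType R}.

Lemma strongly_measurable_glue (g : nat -> measurableTypeR R -> G) (K : R) : 0 <= K ->
  (forall k, strongly_measurable setT (g k)) -> (forall k x, `|g k x| <= K) ->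
  exists q : measurableTypeR R -> G, [/\ strongly_measurable setT q,
    forall x, `|q x| <= K &
    forall (k : nat) (x : R), k%:R < x <= k.+1%:R -> q x = g k x].
Proof.
move=> K0 mg gK.
pose idx (x : R) := xget 0%N [set k : nat | k%:R < x <= k.+1%:R].
have idxE (k : nat) (x : R) : k%:R < x <= k.+1%:R -> idx x = k.
  move=> kx; apply: xget_unique => // j jx; exact: block_unique jx kx.
pose q (x : measurableTypeR R) := if (0 : R) < x then g (idx x) x else 0.
have qE (k : nat) (x : R) : k%:R < x <= k.+1%:R -> q x = g k x.
  move=> kx; rewrite /q (idxE k)// ifT//.
  by rewrite (le_lt_trans (ler0n _ k))//; case/andP: kx.
exists q; split => //; last first.
  by move=> x; rewrite /q; case: ifPn; rewrite ?normr0.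
have /choice[s sg] : forall k, exists s : nat -> measurableTypeR R -> G,
  (forall n, simple_fun (s n)) /\ forall x, s ^~ x @ \oo --> g k x.
  by move=> k; have [s [ss sg]] := mg k; exists s; split => // x; exact: sg.
(* Cutting off at [n] leaves only the blocks k < n, so the range stays finite; for fixed [x] the cut
   is inactive once [n] exceeds its block index. *)
exists (fun n x => if ((0 : R) < x <= n%:R)%R then s (idx x) n x else 0).
pose I k := (`]k%:R, k.+1%:R]%classic : set (measurableTypeR R)).
have mI a b : measurable (`]a, b]%classic : set (measurableTypeR R)).
  by apply: sub_sigma_algebra; exact: is_ocitv.
have inI n (x : R) : 0 < x <= n%:R -> exists2 k, (k < n)%N & k%:R < x <= k.+1%:R.
  move=> /andP[x0 xn]; have [k kx] := exists_block x0; exists k => //.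
  by rewrite -(ltr_nat R); case/andP: kx => kx _; exact: lt_le_trans xn.
have Iin n k (x : R) : (k < n)%N -> k%:R < x <= k.+1%:R -> 0 < x <= n%:R.
  move=> kn /andP[kx xk]; rewrite (le_lt_trans (ler0n _ k) kx)/=.
  by rewrite (le_trans xk)// ler_nat.
split=> [n|x _].
  split.
    apply: (@sub_finite_set _ _ (\bigcup_(k in `I_n) range (s k n) `|` [set 0])).
      move=> _ [x _ <-]; case: ifPn => [/inI[k kn kx]|_]; last by right.
      by left; exists k => //; exists x => //; rewrite (idxE k).
    rewrite finite_setU; split; last exact: finite_set1.
    by apply: bigcup_finite => // k _; exact: ((sg k).1 n).1.
  move=> y; rewrite (_ : _ @^-1` _ = \bigcup_(k in `I_n) (I k `&` s k n @^-1` [set y])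
     `|` (~` `]0, n%:R]%classic `&` [set x | y = 0])).
    apply: measurableU.
      apply: bigcup_measurable => k _; apply: measurableI; first exact: mI.
      by have [_] := (sg k).1 n; exact.
    have [->|/eqP y0] := eqVneq y 0.
      rewrite (_ : [set x | _ = 0] = setT); last by apply/seteqP; split.
      by rewrite setIT; apply: measurableC; exact: mI.
    by rewrite (_ : [set x | y = 0] = set0) ?setI0//; apply/seteqP; split.
  apply/seteqP; split=> x /=.
    case: ifPn => [/inI[k kn kx]|x0] <-; last by right; rewrite in_itv/=; split=> //; exact/negP.
    by left; exists k => //; split; rewrite /I/= ?in_itv//= (idxE k).
  move=> [[k kn [kx <-]]|[/negP x0 ->]].
    by move: kx; rewrite /I /= in_itv/= => kx; rewrite (Iin n k)// (idxE k).
  by rewrite in_itv/= in x0; rewrite (negbTE x0).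
rewrite /q; case: ifPn => [x0|x0]; last by rewrite /=; exact: cvg_cst.
have [k kx] := exists_block x0.
apply: cvg_trans ((sg (idx x)).2 x); apply: near_eq_cvg; near=> n.
suff /andP[_ ->] : (0 : R) < x <= n%:R by [].
by apply: (Iin n k) => //; near: n; exact: nbhs_infty_gt.
Unshelve. all: by end_near. Qed.

End glue.

(** Superadditivity bounds the increments of the variation from below, the majorant K Q from above.
    Time is clamped at 0 because a cumulative function lives on the whole line. *)
Lemma variation_cumulative {R : realType} {G : normedModType R} (A : R -> G)
    (Q : R -> R) (K : R) :
  (forall t, 0 <= t -> Q @ t^'+ --> Q t) -> 0 <= K ->
  (forall s t, 0 <= s -> s <= t -> `|A t - A s| <= K * (Q t - Q s)) ->
  finite_variation A ->
  exists V : cumulative R R,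
    [/\ V 0 = 0, forall t, 0 <= t -> path_variation A t = (V t)%:E,
        forall s t, s <= t -> `|A (Num.max 0 t) - A (Num.max 0 s)| <= V t - V s &
        forall s t, s <= t -> V t - V s <= K * (Q (Num.max 0 t) - Q (Num.max 0 s))].
Proof.
move=> rcQ K0 AQ fvA.
have pv_ge0 t : 0 <= t -> (0 <= path_variation A t)%E.
  move=> t0; rewrite (le_trans _ (path_variation_superadditive A (lexx 0) t0))//.
  by rewrite path_variation0 add0e lee_fin.
pose v t := fine (path_variation A t).
have vE t : 0 <= t -> path_variation A t = (v t)%:E.
  by move=> t0; rewrite /v fineK// ge0_fin_numE ?pv_ge0 ?fvA.
have Av s t : 0 <= s -> s <= t -> `|A t - A s| <= v t - v s.
  move=> s0 st; have := path_variation_superadditive A s0 st.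
  by rewrite !vE ?(le_trans s0)// -EFinD lee_fin; lra.
have vQ s t : 0 <= s -> s <= t -> v t - v s <= K * (Q t - Q s).
  move=> s0 st.
  have AW s' t' : 0 <= s' -> s' <= t' -> `|A t' - A s'| <= K * Q t' - K * Q s'.
    by move=> s'0 st'; rewrite -mulrBr AQ.
  have := path_variation_le AW s0 st.
  by rewrite !vE ?(le_trans s0)// -EFinD lee_fin; lra.
have v_nd s t : 0 <= s -> s <= t -> v s <= v t.
  by move=> s0 st; have := Av s t s0 st; have := normr_ge0 (A t - A s); lra.
have v_rc t : 0 <= t -> v @ t^'+ --> v t.
  move=> t0; apply/cvgrPdist_le => e e0.
  have : (fun s => K * (Q s - Q t)) @ t^'+ --> K * (Q t - Q t).
    by apply: cvgMr; apply: cvgB; [exact: rcQ|exact: cvg_cst].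
  rewrite subrr mulr0 => /cvgrPdist_le/(_ e e0) Qe; near=> s.
  have ts : t <= s by near: s; exact: nbhs_right_ge.
  rewrite distrC ger0_norm ?subr_ge0 ?v_nd//.
  rewrite (le_trans (vQ _ _ t0 ts))// (le_trans (ler_norm _))//.
  by rewrite -normrN -sub0r; near: s.
have [V VE] := cumulative_of v_nd v_rc; exists V.
have max_mono (s t : R) : s <= t -> Num.max 0 s <= Num.max 0 t.
  by move=> st; rewrite ge_max le_max lexx/= le_max st orbT.
have max_ge0 (s : R) : 0 <= Num.max 0 s by rewrite le_max lexx.
split=> [|t t0|s t st|s t st]; rewrite ?VE.
- by rewrite maxxx /v path_variation0.
- by rewrite max_r// vE.
- by rewrite Av// max_mono.
- by rewrite vQ// max_mono.
Unshelve. all: by end_near. Qed.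

Section density.
Context {R : realType} {G : completeNormedModType R}.
Variables (mu : {measure set (measurableTypeR R) -> \bar R}) (QB : R -> G)
  (V : cumulative R R) (q : measurableTypeR R -> G) (K : R).
Hypotheses (muoo : forall s t : R, (mu `]s, t]%classic < +oo)%E)
  (mq : strongly_measurable setT q) (qK : forall x, `|q x| <= K).

Let mitv (s t : R) : measurable (`]s, t]%classic : set (measurableTypeR R)).
Proof. by apply: sub_sigma_algebra; exact: is_ocitv. Qed.

Let intq (s t : R) : bochner_integrable mu `]s, t]%classic q.
Proof.
apply: (@bounded_bochner_integrable _ _ _ _ mu _ (mitv s t) q K) => //.
exact: strongly_measurableS mq.
Qed.

Let mnorm : measurable_fun setT (fun x => `|q x|).
Proof. exact: measurable_norm. Qed.

Let itv_cut (s u t : R) : s <= u -> u <= t ->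
  [/\ `]s, t]%classic = `]s, u]%classic `|` `]u, t]%classic &
    [disjoint `]s, u]%classic & `]u, t]%classic]].
Proof.
move=> su ut; split; first by rewrite -itv_bndbnd_setU ?bnd_simp.
apply/eqP; rewrite -subset0 => x [/=]; rewrite !in_itv/= => /andP[_ xu].
by rewrite ltNge xu.
Qed.

(** The tested identity and the inequality both add up over adjacent intervals, so they extend from
    the blocks; the functionals are removed only at the end. *)
Lemma density_of_blocks :
  (forall (k : nat) (phi : {linear G -> R^o}) s t, (forall z, `|phi z| <= `|z|) ->
    k%:R <= s -> s <= t -> t <= k.+1%:R ->
    phi (QB t - QB s) = \int[mu]_(x in `]s, t]) (phi (q x) : R)) ->
  (forall (k : nat) s t, k%:R <= s -> s <= t -> t <= k.+1%:R ->
    (\int[mu]_(x in `]s, t]) (`|q x|)%:E <= (V t - V s)%:E)%E) ->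
  forall s t, 0 <= s -> s <= t ->
  QB t - QB s = bochner_integral mu `]s, t]%classic q /\
  (\int[mu]_(x in `]s, t]) (`|q x|)%:E <= (V t - V s)%:E)%E.
Proof.
move=> qQB qV s t s0 st; split.
  apply: bochner_integral_unique => // phi phi1.
  move: s t s0 st; apply: block_induction => [s u t s0 su ut su_ ut_|k s t ks st tk]; last first.
    exact: qQB ks st tk.
  have [stE dis] := itv_cut su ut.
  rewrite -(subrKA (QB u)) linearD su_ ut_ stE Rintegral_setU 1?addrC// -?stE.
  apply: functional_integrable => //; first exact: strongly_measurableS mq.
  by apply: bochner_integrable_norm.
move: s t s0 st; apply: block_induction => [s u t s0 su ut su_ ut_|k s t ks st tk]; last first.
  exact: qV ks st tk.
have [stE dis] := itv_cut su ut.
rewrite stE ge0_integral_setU//; last first.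
  by apply/measurable_EFinP; exact: measurable_funTS.
by rewrite (le_trans (leeD su_ ut_))// -EFinD lee_fin; lra.
Qed.

Lemma variation_of_density :
  (forall s t, 0 <= s -> s <= t ->
    QB t - QB s = bochner_integral mu `]s, t]%classic q) ->
  forall t, 0 <= t ->
  (path_variation QB t <= \int[mu]_(x in `]0%R, t]) (`|q x|)%:E)%E.
Proof.
move=> qQB t t0.
have intn (a b : R) : mu.-integrable `]a, b]%classic (fun x => (`|q x|)%:E).
  exact: bochner_integrable_norm.
pose W (r : R) := (\int[mu]_(x in `]0%R, r]) `|q x|)%R.
have QBW r s : 0 <= r -> r <= s -> `|QB s - QB r| <= W s - W r.
  move=> r0 rs; have [E dis] := itv_cut r0 rs.
  rewrite /W E Rintegral_setU// -?E//; rewrite addrAC subrr add0r.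
  apply: norm_le_unit_functional => phi phi1; rewrite qQB//.
  rewrite bochner_integral_functional//; apply: le_Rintegral => //.
    apply: functional_integrable => //; exact: strongly_measurableS mq.
  by move=> x _; rewrite (le_trans (ler_norm _)).
have := path_variation_le QBW (lexx 0) t0.
rewrite path_variation0 add0e => /le_trans; apply.
rewrite {2}/W set_itv_ge ?bnd_simp ?ltxx// Rintegral_set0 subr0 /W /Rintegral.
by rewrite fineK//; exact: integrable_fin_num.
Qed.

End density.

Theorem theorem4p6 (R : realType) (E G : completeNormedModType R)
    (B : {bilinear E -> E -> G}) (pi : nat -> time_partition R)
    (X : R -> E) (QB : R -> G) (Q : increasing_path R) :
  bounded_bilinear B ->
  cadlag X ->
  weak_quadratic_variation B pi X QB ->
  scalar_quadratic_variation pi X Q ->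
  condition_C pi X ->
  radon_nikodym_property G ->
  exists q : R -> G,
    [/\ L1_loc Q q,
        forall t : R, 0 <= t ->
          QB t = bochner_integral (path_measure Q) `]0, t]%classic q,
        {ae path_measure Q, forall s : R, 0 <= s ->
          `|q s| <= bilinear_norm B} &
        forall t : R, 0 <= t ->
          path_variation QB t =
            (\int[path_measure Q]_(s in `]0%R, t]) (`|q s|%R)%:E)%E].
Proof.
move=> bB cX [cQB fvQB cvgQB _] [cvgQ _] [C1 _ C3] RN.
have K0 := bilinear_norm_ge0 bB; set K := bilinear_norm B in K0 *.
have QBQ s t : 0 <= s -> s <= t -> `|QB t - QB s| <= K * (Q t - Q s).
  exact: quadratic_variation_lipschitz cvgQB cvgQ C1 C3.
have [V [V0 VE QBV VQ]] := variation_cumulative (ipath_cadlag Q).1 K0 QBQ fvQB.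
pose mu := path_measure Q.
have muE (s t : R) : s <= t -> mu `]s, t]%classic =
    (path_extension Q t - path_extension Q s)%:E.
  exact: stieltjes_itv.
have muoo (s t : R) : (mu `]s, t]%classic < +oo)%E.
  have [st|ts] := leP s t; first by rewrite muE// ltry.
  by rewrite set_itv_ge ?bnd_simp -?leNgt ?(ltW ts)// measure0 ltry.
have VK (s t : R) (A : set (measurableTypeR R)) : s <= t -> measurable A ->
    A `<=` `]s, t]%classic ->
    (lebesgue_stieltjes_measure V A <= K%:E * mu A)%E.
  move=> st mA Ast; have [K_gt0|] := ltP 0 K.
    exact: (@stieltjes_le_scale _ V (path_extension Q) K A K_gt0 VQ).
  (* For K = 0 the function [V] has no increment on ]s, t], so dV vanishes there. *)
  move=> K_le0; have -> : K = 0 by apply/le_anti; rewrite K_le0 K0.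
  rewrite mul0e; apply: (@le_trans _ _ (lebesgue_stieltjes_measure V `]s, t]%classic)).
    by apply: le_measure; rewrite ?inE//; apply: sub_sigma_algebra; exact: is_ocitv.
  rewrite stieltjes_itv// lee_fin (le_trans (VQ s t st))//.
  by rewrite mulr_le0_ge0// subr_ge0 path_extension_nondecreasing.
have block (k : nat) : exists g : measurableTypeR R -> G,
    [/\ strongly_measurable setT g, forall x, `|g x| <= K,
        forall (phi : {linear G -> R^o}) s t, (forall z, `|phi z| <= `|z|) ->
          k%:R <= s -> s <= t -> t <= k.+1%:R ->
          phi (QB t - QB s) = \int[mu]_(x in `]s, t]) (phi (g x) : R) &
        forall s t, k%:R <= s -> s <= t -> t <= k.+1%:R ->
          (\int[mu]_(x in `]s, t]) (`|g x|)%:E <= (V t - V s)%:E)%E].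
  have kk : k%:R <= k.+1%:R :> R by rewrite ler_nat.
  have [g [mg gK gQB gV]] := stieltjes_density RN kk K0 QBV (muoo _ _)
    (fun A => VK _ _ A kk).
  exists g; split => // phi s t phi1 ks st tk.
  (* The density belongs to the path clamped at 0, which agrees with [QB] on the block. *)
  have s0 : 0 <= s by rewrite (le_trans _ ks).
  by rewrite -gQB// !max_r// (le_trans s0).
have [g gP] := choice block.
have [q [mq qK qg]] := strongly_measurable_glue K0
  (fun k => let: And4 h _ _ _ := gP k in h)
  (fun k => let: And4 _ h _ _ := gP k in h).
have qgk (k : nat) s t : k%:R <= s -> t <= k.+1%:R ->
    {in (`]s, t]%classic : set R), q =1 g k}.
  move=> ks tk x; rewrite inE/= in_itv/= => /andP[sx xt].
  by apply: qg; rewrite (le_lt_trans ks sx) (le_trans xt tk).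
have qQBV : forall s t, 0 <= s -> s <= t ->
    QB t - QB s = bochner_integral mu `]s, t]%classic q /\
    (\int[mu]_(x in `]s, t]) (`|q x|)%:E <= (V t - V s)%:E)%E.
  apply: (density_of_blocks muoo mq qK) => [k phi s t phi1 ks st tk|k s t ks st tk].
    have [_ _ gQB _] := gP k; rewrite (gQB phi s t)//.
    by apply: eq_Rintegral => x xst; rewrite (qgk k s t).
  have [_ _ _ gV] := gP k; rewrite (le_trans _ (gV s t ks st tk))//.
  by rewrite le_eqVlt; apply/orP; left; apply/eqP/eq_integral => x xst; rewrite (qgk k s t).
(* At time 0 all increments vanish, so the weak limit of the sums is 0. *)
have QB0 : QB 0 = 0.
  apply: eq_unit_functional => phi phi1; rewrite linear0.
  have cphi := unit_functional_continuous phi1.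
  apply: (@cvg_unique R^o _ _ _ _ _ (cvgQB 0 (lexx 0) phi cphi)) => //.
  rewrite (_ : phi \o _ = cst 0); first exact: cvg_cst.
  apply/funext => n /=; rewrite fsbig1 ?linear0// => i _.
  by rewrite increment_eq0 ?linear0r// ppoint_ge0.
exists q; split.
- move=> t t0.
  have m0t : measurable (`[0, t]%classic : set (measurableTypeR R)).
    exact: measurable_itv.
  apply: (@bounded_bochner_integrable _ _ _ _ mu _ m0t q K) => //.
    exact: strongly_measurableS mq.
  (* Any negative left end would do: it places [0, t] inside a half-open interval of finite
     measure. *)
  apply: le_lt_trans (muoo (-1) t); apply: le_measure; rewrite ?inE//.
  by apply: subset_itv; rewrite ?bnd_simp// ltrN10.
- by move=> t t0; rewrite -(qQBV 0 t (lexx 0) t0).1 QB0 subr0.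
- by apply: aeW => s _; exact: qK.
- move=> t t0; apply/le_anti/andP; split.
    by apply: (variation_of_density muoo mq qK) => // s u s0 su; exact: (qQBV s u s0 su).1.
  by have := (qQBV 0 t (lexx 0) t0).2; rewrite V0 subr0 VE.
Qed.
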